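(* Let $G\subset \mathrm{GL}(V)$ be a complex reflection group, $N\trianglelefteq G$ a normal reflection subgroup, $H=G/N$ and $E=V/N$. Let $\mathcal{C}_G,\mathcal{C}_N\subset S(V^* )$ and $\mathcal{C}_H\subset S(E^* )=S(V^* )^N$ be the corresponding spaces of harmonic polynomials. Then there is a graded $G$-module isomorphism $\mathcal{C}_G\simeq\mathcal{C}_H\otimes\mathcal{C}_N$ such that $(\mathcal{C}_G)^N\simeq\mathcal{C}_H$ as graded $H$-modules.
   Context: Reflection groups. A reflection on a finite-dimensional complex vector space $V$ is an element of $\mathrm{GL}(V)$ of finite order fixing some hyperplane pointwise. A complex reflection group $G\subset\mathrm{GL}(V)$ is a finite subgroup generated by reflections; a normal reflection subgroup $N\trianglelefteq G$ is a normal subgroup generated by reflections. $S(V^* )$ is the algebra of polynomial functions on $V$, graded by degree (called $\mathbf{x}$-degree). Harmonic polynomials. $\mathcal{C}_G\subset S(V^* )$ is the space of $G$-harmonic polynomials (those annihilated by all $G$-invariant constant-coefficient polynomial differential operators with no constant term); it is a graded $G$-stable complement to the ideal generated by homogeneous $G$-invariants of positive degree. $\mathcal{C}_N\subset S(V^* )$ is defined likewise for $N$, and is $G$-stable. Quotient. There exist homogeneous algebraically independent generators $N_1,\dots,N_r$ ($r=\dim V$) of $S(V^* )^N$ such that $E^*=\mathrm{span}_{\mathbb{C}}\{N_1,\dots,N_r\}$ is $G$-stable. $E$ is the dual of $E^*$, identified with $V/N$, so $S(E^* )=S(V^* )^N\subset S(V^* )$. $H=G/N$ acts on $E$ as a complex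 reflection group, and $\mathcal{C}_H\subset S(E^* )$ is the space of $H$-harmonic polynomials for $H\subset\mathrm{GL}(E)$, regarded as a $G$-module on which $N$ acts trivially. The gradings in the statement are by $\mathbf{x}$-degree: $\mathcal{C}_H\subset S(V^* )^N$ is graded by degree in $S(V^* )$. *)

(* Defs.v *)
From mathcomp Require Export all_boot all_order all_fingroup all_algebra.
From mathcomp Require Export all_character.
From mathcomp Require Export reals.
From mathcomp Require Export complex.
From mathcomp Require Export mpoly.

Set Implicit Arguments.
Unset Strict Implicit.
Unset Printing Implicit Defensive.

Import GRing.Theory.
Local Open Scope ring_scope.

(** Conventions.  V is the space 'cV[C]_n of column vectors, on which matrices
    act on the left; S(V^* ) is {mpoly C[n]}, with 'X_i the i-th coordinate
    function.  A group acting linearly on V is given by a finite group together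
    with a matrix-valued function rho on it (in practice an mx_representation);
    "G is a subgroup of GL(V)" means that this representation is faithful. *)

(** ** Reflection groups *)

(** The hyperplane is given as the kernel of a nonzero linear form l. *)
Definition is_reflection (C : fieldType) (n : nat) (A : 'M[C]_n) : Prop :=
  [/\ A \in unitmx,
      exists2 k : nat, (0 < k)%N & A ^+ k = 1%:M
    & exists2 l : 'rV[C]_n, l != 0 &
        forall v : 'cV[C]_n, l *m v = 0 -> A *m v = v].

Definition generated_by_reflections (C : fieldType) (gT : finGroupType)
    (n : nat) (rho : gT -> 'M[C]_n) (G : {group gT}) : Prop :=
  exists2 S : {set gT},
    (forall s, s \in S -> is_reflection (rho s)) & <<S>>%g = G :> {set gT}.

(** ** Action on polynomial functions *)

Definition precomp (C : fieldType) (n : nat) (A : 'M[C]_n)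
    (f : {mpoly C[n]}) : {mpoly C[n]} :=
  f \mPo [tuple \sum_(j < n) A i j *: 'X_j | i < n].

(** (g . f)(v) = f (g^-1 v) *)
Definition poly_act (C : fieldType) (gT : finGroupType) (n : nat)
    (rho : gT -> 'M[C]_n) (g : gT) (f : {mpoly C[n]}) : {mpoly C[n]} :=
  precomp (rho g^-1%g) f.

Definition poly_invariant (C : fieldType) (gT : finGroupType) (n : nat)
    (rho : gT -> 'M[C]_n) (A : {set gT}) (f : {mpoly C[n]}) : Prop :=
  forall g, g \in A -> poly_act rho g f = f.

(** ** Harmonic polynomials *)

(** The constant-coefficient operator D(d/dx_1, ..., d/dx_n). *)
Definition diffop (C : fieldType) (n : nat) (D f : {mpoly C[n]}) :
    {mpoly C[n]} :=
  \sum_(m <- msupp D) D@_m *: f^`M[m].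

(** Invariance of an operator is for the conjugation action D |-> g D g^-1. *)
Definition invariant_diffop (C : fieldType) (gT : finGroupType) (n : nat)
    (rho : gT -> 'M[C]_n) (A : {set gT}) (D : {mpoly C[n]}) : Prop :=
  forall g, g \in A ->
    forall f, diffop D (poly_act rho g f) = poly_act rho g (diffop D f).

Definition is_harmonic (C : fieldType) (gT : finGroupType) (n : nat)
    (rho : gT -> 'M[C]_n) (A : {set gT}) (f : {mpoly C[n]}) : Prop :=
  forall D : {mpoly C[n]},
    D@_0%MM = 0 -> invariant_diffop rho A D -> diffop D f = 0.

(** ** The quotient E = V/N *)

(** Ns lists generators N_1, ..., N_r as in the definition of E: their span
    E^* is G-stable. *)
Definition quotient_coordinates (C : fieldType) (gT : finGroupType) (n : nat)
    (rho : gT -> 'M[C]_n) (G N : {set gT}) (Ns : n.-tuple {mpoly C[n]}) :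
    Prop :=
  [/\ forall i, exists d : nat, tnth Ns i \is d.-homog,
      forall p : {mpoly C[n]}, p \mPo Ns = 0 -> p = 0,
      forall f : {mpoly C[n]},
        poly_invariant rho N f <-> exists p : {mpoly C[n]}, f = p \mPo Ns
    & forall g, g \in G -> forall i, exists c : 'I_n -> C,
        poly_act rho g (tnth Ns i) = \sum_(j < n) c j *: tnth Ns j].

(** E is identified with 'cV[C]_n through the basis dual to N_1, ..., N_r, so
    that S(E^* ) is {mpoly C[n]} with 'X_i standing for N_i, and the inclusion
    of S(E^* ) in S(V^* ) is p |-> p \mPo Ns.  The condition says that rhoE is
    the action of G/N on E dual to its action on E^*. *)
Definition quotient_rep (C : fieldType) (gT : finGroupType) (n : nat)
    (rho : gT -> 'M[C]_n) (G N : {group gT}) (Ns : n.-tuple {mpoly C[n]})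
    (rhoE : coset_of N -> 'M[C]_n) : Prop :=
  forall g, g \in G -> forall i,
    poly_act rho g (tnth Ns i) = poly_act rhoE (coset N g) 'X_i \mPo Ns.

(** The space of H-harmonic polynomials, H = G/N, regarded inside S(V^* ). *)
Definition quotient_harmonic (C : fieldType) (gT : finGroupType) (n : nat)
    (G N : {group gT}) (Ns : n.-tuple {mpoly C[n]})
    (rhoE : coset_of N -> 'M[C]_n) (f : {mpoly C[n]}) : Prop :=
  exists2 p : {mpoly C[n]}, is_harmonic rhoE (G / N)%g p & f = p \mPo Ns.

(** The action of G/N on S(V^* )^N; on N-invariants it does not depend on the
    representative. *)
Definition coset_poly_act (C : fieldType) (gT : finGroupType) (n : nat)
    (rho : gT -> 'M[C]_n) (N : {group gT}) (h : coset_of N)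
    (f : {mpoly C[n]}) : {mpoly C[n]} :=
  poly_act rho (repr h) f.

(** ** Tensor products *)

(** S(V^* ) (x) S(V^* ) is identified with the polynomial functions on V + V,
    f (x) f' being the function (v, v') |-> f v * f' v'.  Its grading is by
    total degree, and G acts through its diagonal action on V + V. *)
Definition tens (C : fieldType) (n : nat) (f f' : {mpoly C[n]}) :
    {mpoly C[n + n]} :=
  (f \mPo [tuple 'X_(lshift n i) | i < n]) *
  (f' \mPo [tuple 'X_(rshift n i) | i < n]).

Definition diag_rep (C : fieldType) (gT : finGroupType) (n : nat)
    (rho : gT -> 'M[C]_n) (g : gT) : 'M[C]_(n + n) :=
  block_mx (rho g) 0 0 (rho g).

(** For subspaces U, W of S(V^* ), the subspace U (x) W. *)
Definition tensor_space (C : fieldType) (n : nat)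
    (U W : {mpoly C[n]} -> Prop) (t : {mpoly C[n + n]}) : Prop :=
  exists2 s : seq ({mpoly C[n]} * {mpoly C[n]}),
    forall p, p \in s -> U p.1 /\ W p.2
  & t = \sum_(p <- s) tens p.1 p.2.

(** ** Graded isomorphisms *)

(** phi restricts to an isomorphism of graded modules from the subspace U to
    the subspace W, on which the elements of A act by aU and aW; its values
    outside U are irrelevant. *)
Definition graded_iso (C : fieldType) (gT : finGroupType) (A : {set gT})
    (n m : nat)
    (aU : gT -> {mpoly C[n]} -> {mpoly C[n]})
    (aW : gT -> {mpoly C[m]} -> {mpoly C[m]})
    (U : {mpoly C[n]} -> Prop) (W : {mpoly C[m]} -> Prop)
    (phi : {mpoly C[n]} -> {mpoly C[m]}) : Prop :=
  [/\ forall (c : C) u v, U u -> U v -> phi (c *: u + v) = c *: phi u + phi v,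
      forall u, U u -> W (phi u),
      forall w, W w -> exists! u, U u /\ phi u = w,
      forall g u, g \in A -> U u -> phi (aU g u) = aW g (phi u)
    & forall d u, U u -> (phi u \is d.-homog) = (u \is d.-homog)].

(* Main.v *)
Require Import Defs.
From HB Require Import structures.
From mathcomp Require Import boolp ring ssrcomplements.

(** Write S for S(V^* ), S^K for the invariants of a finite linear group K and
    I_K for the ideal generated by the invariants without constant term.

    Harmonic polynomials represent S modulo I_K: one has S = C_K + I_K, and
    the sum is direct.  An invariant Hermitian form on V induces a positive
    definite Hermitian form on S, the apolar form (p, q) |-> (p~(d) q)(0),
    where p~ is the differential operator corresponding to p.  Multiplication
    by p is adjoint to p~(d), and p |-> p~ carries invariants to invariant
    operators, so C_K is the orthogonal of I_K ([harmonicP],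
    [harmonic_decomposition], [harmonic_ideal0]).  This is applied to G and N
    on V, and to H on E.  On E the grading by degree in S is the one giving
    the coordinate N_i the weight deg N_i.  As H preserves these weights, C_H
    and I_H are graded for it ([iota_weights]).

    The isomorphism is induced by multiplication, C_H (x) C_N -> S -> S / I_G,
    the target being identified with C_G.  It is surjective because
    S = S^N C_N by degree induction ([harmonic_span_full]), while
    S^N = C_H + I_H and I_H is contained in I_G ([iota_ideal]).

    It is injective because S is free over S^N.  By Chevalley's argument with
    divided differences, polynomials that are linearly independent modulo I_N
    are linearly independent over S^N when N is generated by reflections
    ([chevalley], [independent_over_invariants]).  Let b_j be linearly
    independent in C_N and suppose that sum_j h_j b_j lies in I_G, with h_j in
    C_H.  Expanding S = S^N C_N and enlarging the family b, this element is
    also sum_j i_j b_j with i_j in I_H ([hilbert_ideal_expansion]).  Freeness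
    gives h_j = i_j, which is 0 since C_H and I_H are disjoint
    ([tensor_harmonic_disjoint]).

    Congruence modulo I_G thus identifies C_G with C_H (x) C_N.  The
    N-invariants of C_G are congruent to elements of S^N = C_H + I_H, hence to
    elements of C_H (x) 1.  This gives both the second isomorphism and its
    compatibility with the first. *)

Set Implicit Arguments.
Unset Strict Implicit.
Unset Printing Implicit Defensive.

Import GRing.Theory Num.Theory.
Local Open Scope ring_scope.

(** * Spans, free families and orthogonal projections *)

Section Spans.
Variables (F : fieldType) (V : lmodType F).

Definition subspace (W : V -> Prop) : Prop :=
  W 0 /\ forall (c : F) u v, W u -> W v -> W (c *: u + v).

Fixpoint in_span (es : seq V) (v : V) : Prop :=
  if es is e :: es' then exists a, in_span es' (v - a *: e) else v = 0.

Fixpoint free_family (bs : seq V) : Prop :=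
  if bs is b :: bs' then ~ in_span bs' b /\ free_family bs' else True.

Lemma subspaceD W u v : subspace W -> W u -> W v -> W (u + v).
Proof. by case=> _ WP Wu Wv; rewrite -[u]scale1r; apply: WP. Qed.

Lemma subspaceZ W c u : subspace W -> W u -> W (c *: u).
Proof. by case=> W0 WP Wu; rewrite -[_ *: _]addr0; apply: WP. Qed.

Lemma subspaceN W u : subspace W -> W u -> W (- u).
Proof. by move=> sW Wu; rewrite -scaleN1r; apply: subspaceZ. Qed.

Lemma subspaceB W u v : subspace W -> W u -> W v -> W (u - v).
Proof. by move=> sW Wu Wv; apply: subspaceD => //; apply: subspaceN. Qed.

Lemma subspace_sum W (I : Type) (s : seq I) (P : pred I) (E : I -> V) :
  subspace W -> (forall i, P i -> W (E i)) -> W (\sum_(i <- s | P i) E i).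
Proof.
move=> sW WE; elim/big_ind: _ => //; first by case: sW.
by move=> u v; apply: subspaceD.
Qed.

Lemma in_span_subspace es : subspace (in_span es).
Proof.
elim: es => [|e es [IH0 IHP]]; split=> //=.
- by move=> c u v -> ->; rewrite scaler0 addr0.
- by exists 0; rewrite scale0r subr0.
move=> c u v [a Ha] [b Hb]; exists (c * a + b).
rewrite scalerDl -scalerA opprD addrACA -scalerN -scalerDr.
exact: IHP.
Qed.

Lemma in_span_cons e es v : in_span es v -> in_span (e :: es) v.
Proof. by exists 0; rewrite scale0r subr0. Qed.

Lemma in_span_head e es : in_span (e :: es) e.
Proof. by exists 1; rewrite scale1r subrr; case: (in_span_subspace es). Qed.

Lemma in_span_mem (T : eqType) (f : T -> V) (s : seq T) x :
  x \in s -> in_span (map f s) (f x).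
Proof.
elim: s => //= y s IHs; rewrite inE => /orP[/eqP->|/IHs].
  exact: in_span_head.
exact: in_span_cons.
Qed.

Lemma in_spanP es v : in_span es v ->
  exists c : 'I_(size es) -> F, v = \sum_i c i *: es`_i.
Proof.
elim: es v => [|e es IHes] v /=.
  by move=> ->; exists (fun=> 0); rewrite big_ord0.
case=> a /IHes[c Dv].
exists (fun i => if unlift ord0 i is Some j then c j else a).
rewrite big_ord_recl unlift_none /= -(subrK (a *: e) v) Dv addrC.
by congr (_ + _); apply: eq_bigr => i _; rewrite liftK.
Qed.

Lemma in_span_sum es (c : 'I_(size es) -> F) : in_span es (\sum_i c i *: es`_i).
Proof.
elim: es c => [|e es IHes] c; first by rewrite big_ord0.
rewrite big_ord_recl; exists (c ord0).
by rewrite addrC addKr; apply: (IHes (fun i => c (lift ord0 i))).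
Qed.

Lemma free_family_extract (cs : seq V) : exists bs : seq V,
  [/\ free_family bs, {subset bs <= cs} & {in cs, forall c, in_span bs c}].
Proof.
elim: cs => [|c cs [bs [fbs sbs cbs]]]; first by exists [::].
have [cin|cnin] := EM (in_span bs c).
  exists bs; split=> // [b /sbs bcs|c']; rewrite inE ?bcs ?orbT //.
  by case/orP=> [/eqP->|/cbs].
exists (c :: bs); split=> // [b|c']; rewrite !inE.
  by case/orP=> [->|/sbs ->]; rewrite ?orbT.
case/orP=> [/eqP->|/cbs]; [exact: in_span_head | exact: in_span_cons].
Qed.

Lemma free_family_coeffs bs : free_family bs ->
  forall c : 'I_(size bs) -> F, \sum_i c i *: bs`_i = 0 -> forall i, c i = 0.
Proof.
elim: bs => [_ c _ []//|b bs IHbs [bnin fbs] c].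
rewrite big_ord_recl /= => c0.
have {}bc0 : c ord0 = 0.
  apply/eqP/negPn/negP => nz; apply: bnin.
  have -> : b = - (c ord0)^-1 *: \sum_(i < size bs) c (lift ord0 i) *: bs`_i.
    rewrite -[in LHS](scale1r b) -(mulVf nz) -scalerA scaleNr -scalerN.
    by congr (_ *: _); apply/eqP; rewrite -addr_eq0 -[in X in _ == X]c0.
  apply: subspaceZ; first exact: in_span_subspace.
  exact: (in_span_sum (fun i => c (lift ord0 i))).
move: c0; rewrite bc0 scale0r add0r => c0 i.
by case: (unliftP ord0 i) => [j ->|->//]; apply: (IHbs fbs _ c0).
Qed.

End Spans.

Section Projection.
Variables (C : numClosedFieldType) (V : lmodType C) (b : V -> V -> C).
Hypothesis b_linear : forall u c v w, b u (c *: v + w) = c * b u v + b u w.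
Hypothesis b_sym : forall u v, b u v = (b v u)^*.
Hypothesis b_pos : forall u, b u u = 0 -> u = 0.

(** Induction on the family spanning W.  If W is not in the span of es, some
    w0 in W involves e.  Then W is the line of w1, the component of w0
    orthogonal to the part of W inside the span of es, plus that part. *)
Lemma orthogonal_projection (es : seq V) (W : V -> Prop) :
  subspace W -> (forall w, W w -> in_span es w) ->
  forall v, exists w, W w /\ forall u, W u -> b u (v - w) = 0.
Proof.
have bB u v w : b u (v - w) = b u v - b u w.
  by rewrite addrC -scaleN1r b_linear mulN1r addrC.
have b0 u : b u 0 = 0 by rewrite -[X in b u X](subrr 0) bB subrr.
elim: es W => [|e es IHes] W sW Wes v.
  exists 0; split; first by case: sW.
  by move=> u /Wes ->; rewrite b_sym b0 conjC0.
have sU : subspace (fun w => W w /\ in_span es w).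
  have [s0 sP] := in_span_subspace es; have [W0 WP] := sW.
  by split=> // c u w [Wu Eu] [Ww Ew]; split; [apply: WP | apply: sP].
have proj := IHes _ sU (fun w => @proj2 _ _).
have [allU|[w0 Ww0 nUw0]] : (forall w, W w -> in_span es w)
    \/ exists2 w0, W w0 & ~ in_span es w0.
- have [[w0 Ww0 nw0]|none] := EM (exists2 w0, W w0 & ~ in_span es w0).
    by right; exists w0.
  by left=> w Ww; apply: contrapT => nw; apply: none; exists w.
- have [w [[Ww _] ow]] := proj v; exists w; split=> // u Wu.
  by apply: ow; split=> //; apply: allU.
have [p0 [[Wp0 Ep0] op0]] := proj w0.
pose w1 := w0 - p0.
have Ww1 : W w1 by apply: subspaceB.
have nz1 : b w1 w1 != 0.
  apply/eqP => /b_pos w10; apply: nUw0.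
  by rewrite (_ : w0 = p0) //; apply/eqP; rewrite -subr_eq0 -/w1 w10.
have split_w w : W w -> exists c, in_span es (w - c *: w1).
  move=> Ww; have [a0 Ha0] := Wes _ Ww1; have [a Ha] := Wes _ Ww.
  have nza0 : a0 != 0.
    apply/eqP => a00; apply: nUw0; rewrite -[w0](subrK p0).
    apply: subspaceD => //; first exact: in_span_subspace.
    by move: Ha0; rewrite a00 scale0r subr0.
  exists (a / a0).
  have -> : w - (a / a0) *: w1 = (w - a *: e) - (a / a0) *: (w1 - a0 *: e).
    by rewrite [_ *: (w1 - _)]scalerBr scalerA divfK // opprB addrA subrK.
  by apply: subspaceB (in_span_subspace _) _ _ => //;
     apply: subspaceZ (in_span_subspace _) _.
have [p [[Wp Ep] op]] := proj v.
pose c := b w1 (v - p) / b w1 w1.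
exists (c *: w1 + p); split; first by case: sW => _; apply.
move=> u Wu; have [a Ha] := split_w u Wu.
set u' := u - a *: w1 in Ha.
have Wu' : W u' by apply: subspaceB => //; apply: subspaceZ.
have -> : u = a *: w1 + u' by rewrite addrC subrK.
rewrite b_sym b_linear.
have b1 : b (v - (c *: w1 + p)) w1 = 0.
  rewrite b_sym [c *: w1 + p]addrC opprD addrA bB -[c *: w1]addr0 b_linear.
  by rewrite b0 addr0 divfK // subrr conjC0.
have b2 : b (v - (c *: w1 + p)) u' = 0.
  rewrite b_sym [c *: w1 + p]addrC opprD addrA bB op // sub0r.
  rewrite -[c *: w1]addr0 b_linear op0 //.
  by rewrite b0 mulr0 addr0 oppr0 conjC0.
by rewrite b1 b2 mulr0 addr0 conjC0.
Qed.

End Projection.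

(** * Linear substitutions and gradings *)

Section Polynomials.
Variable (C : fieldType).

Lemma mpoly_ind_lin n (P : {mpoly C[n]} -> Prop) :
    (forall m, P 'X_[m]) -> (forall c p q, P p -> P q -> P (c *: p + q)) ->
    P 0 -> forall p, P p.
Proof. by move=> PX PL P0; elim/mpolyind=> // c m p _ _ Pp; apply: PL. Qed.

Lemma mpoly_ind_alg n (P : {mpoly C[n]} -> Prop) :
    (forall c, P c%:MP) -> (forall i, P 'X_i) ->
    (forall p q, P p -> P q -> P (p + q)) ->
    (forall p q, P p -> P q -> P (p * q)) -> forall p, P p.
Proof.
move=> PC PX PD PM; elim/mpoly_ind_lin=> [m|c p q Pp Pq|].
- rewrite mpolyXE_id; elim/big_ind: _ => // [|i _]; first exact: (PC 1).
  elim: (m i) => [|k IHk]; first by rewrite expr0; apply: (PC 1).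
  by rewrite exprS; apply: PM.
- by rewrite -mul_mpolyC; apply: PD => //; apply: PM.
by rewrite -mpolyC0; apply: PC.
Qed.

Lemma mcoeff0_comp n k (lq : n.-tuple {mpoly C[k]}) p :
  (forall i, (tnth lq i)@_0%MM = 0) -> (p \mPo lq)@_0%MM = p@_0%MM.
Proof.
move=> lq0; elim/mpoly_ind_alg: p => [c|i|p q Hp Hq|p q Hp Hq].
- by rewrite comp_mpolyC !mpolyCK.
- by rewrite comp_mpolyXU -tnth_nth lq0 mcoeffX mnm1_eq0.
- by rewrite comp_mpolyD !mcoeffD Hp Hq.
- by rewrite rmorphM /= !(rmorphM (mcoeff 0%MM)) /= Hp Hq.
Qed.

Definition wdeg n (w : 'I_n -> nat) (m : 'X_{1..n}) : nat :=
  (\sum_(i < n) m i * w i)%N.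

Lemma wdeg0 n (w : 'I_n -> nat) : wdeg w 0%MM = 0%N.
Proof. by rewrite /wdeg big1 // => i _; rewrite mnm0E mul0n. Qed.

Lemma wdegD n (w : 'I_n -> nat) :
  {morph wdeg w : m1 m2 / (m1 + m2)%MM >-> (m1 + m2)%N}.
Proof.
move=> m1 m2; rewrite /wdeg -big_split /=.
by apply: eq_bigr => i _; rewrite mnmDE mulnDl.
Qed.

HB.instance Definition _ n (w : 'I_n -> nat) :=
  isMeasure.Build n (wdeg w) (wdeg0 w) (@wdegD n w).

Lemma wdegU n (w : 'I_n -> nat) i : wdeg w U_(i)%MM = w i.
Proof.
rewrite /wdeg (bigD1 i) //= mnm1E eqxx mul1n big1 ?addn0 // => j ji.
by rewrite mnm1E eq_sym (negPf ji).
Qed.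

(** Used for linear substitutions, for the inclusion of S(E^* ) in S(V^* )
    with the weights deg N_i, and for the maps to and from V + V. *)
Lemma pihomog_comp n k (mf : measure n) (mf' : measure k)
    (lq : n.-tuple {mpoly C[k]}) d p :
  (forall i, tnth lq i \is (mf U_(i)%MM).-homog for mf') ->
  pihomog mf' d (p \mPo lq) = pihomog mf d p \mPo lq.
Proof.
move=> lqh; elim/mpoly_ind_lin: p => [m|c p q Hp Hq|]; last by rewrite !linear0.
  have Xh : 'X_[m] \mPo lq \is (mf m).-homog for mf'.
    rewrite comp_mpolyX mfE.
    elim/big_ind2: _ => [|p d1 q d2|i _]; first exact: dhomog1.
      exact: dhomogM.
    by rewrite mulnC; apply: dhomogMn.
  rewrite pihomogX; case: eqP => [<-|/eqP ne]; first by rewrite pihomog_dE.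
  by rewrite (pihomog_ne0 ne Xh) linear0.
by rewrite !linearP /= Hp Hq.
Qed.

Lemma pihomogM n (mf : measure n) d (p q : {mpoly C[n]}) :
  pihomog mf d (p * q) =
  \sum_(e < d.+1) pihomog mf e p * pihomog mf (d - e) q.
Proof.
elim/mpoly_ind_lin: p => [m|c p1 p2 H1 H2|].
- elim/mpoly_ind_lin: q => [m'|c q1 q2 H1 H2|].
  + rewrite -mpolyXD pihomogX mfD; have [md|md] := ltnP (mf m) d.+1.
      rewrite (bigD1 (Ordinal md)) //= big1 ?addr0 => [|e ne].
        rewrite !pihomogX eqxx -[in RHS](eqn_add2l (mf m)) subnKC //.
        by case: eqP; rewrite ?mulr0 // mpolyXD.
      rewrite pihomogX; case: eqP => [De|]; last by rewrite mul0r.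
      by case/eqP: ne; apply: val_inj.
    rewrite gtn_eqF ?(leq_trans md) ?leq_addr // big1 // => e _.
    rewrite pihomogX gtn_eqF ?mul0r //.
    by rewrite (leq_trans _ md).
  + rewrite mulrDr -scalerAr linearP /= H1 H2 scaler_sumr -big_split /=.
    by apply: eq_bigr => e _; rewrite linearP /= mulrDr -scalerAr.
  + by rewrite mulr0 linear0 big1 // => e _; rewrite linear0 mulr0.
- rewrite mulrDl -scalerAl linearP /= H1 H2 scaler_sumr -big_split /=.
  by apply: eq_bigr => e _; rewrite linearP /= mulrDl -scalerAl.
by rewrite mul0r linear0 big1 // => e _; rewrite linear0 mul0r.
Qed.

Lemma pihomog0_coef n (p : {mpoly C[n]}) : pihomog mdeg 0 p = (p@_0%MM)%:MP.
Proof.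
elim/mpoly_ind_lin: p => [m|c p q Hp Hq|].
- rewrite pihomogX mcoeffX mdeg_eq0; case: eqP => [->|]; last by rewrite mpolyC0.
  by rewrite mpolyX0 mpolyC1.
- by rewrite linearP /= Hp Hq mcoeffD mcoeffZ mpolyCD mpolyCM mul_mpolyC.
by rewrite linear0 mcoeff0 mpolyC0.
Qed.

Lemma mcoeff_pihomog n (mf : measure n) d (p : {mpoly C[n]}) m :
  (pihomog mf d p)@_m = if mf m == d then p@_m else 0.
Proof.
elim/mpoly_ind_lin: p => [m'|c p q Hp Hq|].
- rewrite pihomogX; have [<-|ne] := eqVneq m' m.
    by case: ifP => //; rewrite mcoeff0.
  by rewrite mcoeffX (negPf ne) if_same; case: ifP; rewrite ?mcoeff0 // mcoeffX (negPf ne).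
- rewrite linearP /= !mcoeffD !mcoeffZ Hp Hq.
  by case: ifP => //; rewrite mulr0 addr0.
by rewrite linear0 mcoeff0 if_same.
Qed.

Lemma msize_pihomog n (p : {mpoly C[n]}) d : (msize (pihomog mdeg d p) <= d.+1)%N.
Proof.
have [->|nz] := eqVneq (pihomog mdeg d p) 0; first by rewrite msize0.
by rewrite -(mlead_deg nz) (dhomog_mf (pihomogP mdeg d p) (mlead_supp nz)).
Qed.

Lemma pihomog_msize n (p : {mpoly C[n]}) d :
  (msize p <= d)%N -> pihomog mdeg d p = 0.
Proof.
move=> led; rewrite pihomogE big_seq_cond big1 // => m /andP[mp /eqP md].
by have := msize_mdeg_lt mp; rewrite md ltnNge led.
Qed.

End Polynomials.

Section Substitution.
Variables (C : fieldType) (n : nat).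
Implicit Types (A B : 'M[C]_n) (p q : {mpoly C[n]}).

Lemma precompX A i : precomp A 'X_i = \sum_(j < n) A i j *: 'X_j.
Proof. by rewrite /precomp comp_mpolyXU -tnth_nth tnth_mktuple. Qed.

Lemma precompC A c : precomp A c%:MP = c%:MP.
Proof. exact: comp_mpolyC. Qed.

Lemma precompD A p q : precomp A (p + q) = precomp A p + precomp A q.
Proof. exact: comp_mpolyD. Qed.

Lemma precompB A p q : precomp A (p - q) = precomp A p - precomp A q.
Proof. exact: comp_mpolyB. Qed.

Lemma precompZ A c p : precomp A (c *: p) = c *: precomp A p.
Proof. exact: comp_mpolyZ. Qed.

Lemma precompM A p q : precomp A (p * q) = precomp A p * precomp A q.
Proof. by rewrite /precomp rmorphM. Qed.

Lemma precomp0 A : precomp A 0 = 0.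
Proof. exact: comp_mpoly0. Qed.

Lemma precomp_sum A (I : Type) (s : seq I) (P : pred I) (E : I -> {mpoly C[n]}) :
  precomp A (\sum_(i <- s | P i) E i) = \sum_(i <- s | P i) precomp A (E i).
Proof. exact: raddf_sum. Qed.

Lemma precomp_comp A B p : precomp A (precomp B p) = precomp (B *m A) p.
Proof.
elim/mpoly_ind_alg: p => [c|i|p q Hp Hq|p q Hp Hq].
- by rewrite !precompC.
- rewrite !precompX precomp_sum.
  under eq_bigr do rewrite precompZ precompX scaler_sumr.
  rewrite exchange_big; apply: eq_bigr => k _.
  by rewrite mxE scaler_suml; apply: eq_bigr => j _; rewrite scalerA.
- by rewrite !precompD Hp Hq.
- by rewrite !precompM Hp Hq.
Qed.

Lemma precomp1 p : precomp 1%:M p = p.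
Proof.
elim/mpoly_ind_alg: p => [c|i|p q Hp Hq|p q Hp Hq].
- exact: precompC.
- rewrite precompX (bigD1 i) //= mxE eqxx scale1r big1 ?addr0 // => j ji.
  by rewrite mxE eq_sym (negPf ji) scale0r.
- by rewrite precompD Hp Hq.
- by rewrite precompM Hp Hq.
Qed.

Lemma precompK A : A \in unitmx -> cancel (precomp A) (precomp (invmx A)).
Proof. by move=> uA p; rewrite precomp_comp mulmxV // precomp1. Qed.

Lemma precompVK A : A \in unitmx -> cancel (precomp (invmx A)) (precomp A).
Proof. by move=> uA p; rewrite precomp_comp mulVmx // precomp1. Qed.

Lemma linear_form_homog (a : 'I_n -> C) (w : 'I_n -> nat) d :
  (forall j, a j != 0 -> w j = d) ->
  \sum_(j < n) a j *: 'X_j \is d.-homog for (wdeg w).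
Proof.
move=> aw; apply: rpred_sum => j _.
have [->|nz] := eqVneq (a j) 0; first by rewrite scale0r rpred0.
by apply: rpredZ; rewrite dhomogX /= wdegU aw.
Qed.

Lemma linear_form_dhomog (a : 'I_n -> C) :
  \sum_(j < n) a j *: 'X_j \is 1.-homog.
Proof. by apply: rpred_sum => j _; apply: rpredZ; rewrite dhomogX /= mdeg1. Qed.

Lemma mcoeff0_precomp A p : (precomp A p)@_0%MM = p@_0%MM.
Proof.
apply: mcoeff0_comp => i; rewrite tnth_mktuple.
by apply: (dhomog_nemf_coeff (linear_form_dhomog _)); rewrite [X in X != _]mdeg0.
Qed.

Lemma pihomog_precomp A d p :
  pihomog mdeg d (precomp A p) = precomp A (pihomog mdeg d p).
Proof.
apply: pihomog_comp => i.
by rewrite tnth_mktuple /= mdeg1; apply: linear_form_dhomog.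
Qed.

Lemma wpihomog_precomp (w : 'I_n -> nat) A d p :
  (forall i j, A i j != 0 -> w i = w j) ->
  pihomog (wdeg w) d (precomp A p) = precomp A (pihomog (wdeg w) d p).
Proof.
move=> Aw; apply: pihomog_comp => i.
rewrite tnth_mktuple /= wdegU; apply: linear_form_homog => j nz.
by rewrite (Aw i j).
Qed.

Lemma msize_precomp A p : (msize (precomp A p) <= msize p)%N.
Proof.
rewrite leqNgt; apply/negP => lt.
have nz : precomp A p != 0.
  by apply: contraTneq lt => ->; rewrite msize0.
have := pihomog_precomp A (mdeg (mlead (precomp A p))) p.
rewrite (@pihomog_msize _ _ p) ?precomp0; last by rewrite -ltnS mlead_deg.
move/(congr1 (mcoeff (mlead (precomp A p)))).
by rewrite mcoeff0 mcoeff_pihomog /= eqxx => /eqP; rewrite mleadc_eq0 (negPf nz).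
Qed.

End Substitution.

(** * Constant-coefficient differential operators *)

Section Diffop.
Variables (C : fieldType) (n : nat).
Implicit Types (A : 'M[C]_n) (D E p q : {mpoly C[n]}).

Lemma diffopwE k D p : (msize D <= k)%N ->
  diffop D p = \sum_(m : 'X_{1..n < k}) D@_m *: p^`M[m].
Proof.
move=> le_Dk; set I : subFinType _ := 'X_{1..n < k}.
rewrite /diffop (big_mksub I) ?msupp_uniq //=; first last.
  by move=> x /msize_mdeg_lt /leq_trans; apply.
by rewrite big_rmcond //= => j /memN_msupp_eq0 ->; rewrite scale0r.
Qed.

Lemma diffopPl c D E p : diffop (c *: D + E) p = c *: diffop D p + diffop E p.
Proof.
pose k := maxn (msize D) (msize E).
have leD : (msize D <= k)%N by rewrite leq_maxl.
have leE : (msize E <= k)%N by rewrite leq_maxr.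
have leP : (msize (c *: D + E) <= k)%N.
  apply: leq_trans (msizeD_le _ _) _; rewrite geq_max leE andbT.
  exact: leq_trans (msizeZ_le _ _) leD.
rewrite !(diffopwE p (k := k)) // scaler_sumr -big_split /=.
by apply: eq_bigr => m _; rewrite mcoeffD mcoeffZ scalerDl scalerA.
Qed.

Lemma diffopPr D c p q : diffop D (c *: p + q) = c *: diffop D p + diffop D q.
Proof.
rewrite /diffop scaler_sumr -big_split /=; apply: eq_bigr => m _.
by rewrite linearP /= scalerDr !scalerA mulrC.
Qed.

Lemma diffop0l p : diffop 0 p = 0.
Proof. by rewrite /diffop msupp0 big_nil. Qed.

Lemma diffop0r D : diffop D 0 = 0.
Proof. by rewrite /diffop big1 // => m _; rewrite linear0 scaler0. Qed.

Lemma diffopDl D E p : diffop (D + E) p = diffop D p + diffop E p.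
Proof. by rewrite -[D]scale1r diffopPl !scale1r. Qed.

Lemma diffopZl c D p : diffop (c *: D) p = c *: diffop D p.
Proof. by rewrite -[_ *: D]addr0 diffopPl diffop0l addr0. Qed.

Lemma diffop_suml (I : Type) (s : seq I) (P : pred I) (E : I -> {mpoly C[n]}) p :
  diffop (\sum_(i <- s | P i) E i) p = \sum_(i <- s | P i) diffop (E i) p.
Proof.
by apply: (big_morph (fun D => diffop D p) _ (diffop0l p)) => D F; apply: diffopDl.
Qed.

Lemma diffopX m p : diffop 'X_[m] p = p^`M[m].
Proof. by rewrite /diffop msuppX big_seq1 mcoeffX eqxx scale1r. Qed.

Lemma diffopC c p : diffop c%:MP p = c *: p.
Proof.
by rewrite -[c%:MP]mulr1 mul_mpolyC diffopZl -mpolyX0 diffopX mderivm0m.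
Qed.

Lemma diffopM D E p : diffop (D * E) p = diffop D (diffop E p).
Proof.
elim/mpoly_ind_lin: D => [m|c D1 D2 H1 H2|].
- elim/mpoly_ind_lin: E => [m'|c E1 E2 H1 H2|].
  + by rewrite -mpolyXD !diffopX addmC mderivmDm.
  + by rewrite mulrDr -scalerAr !diffopPl diffopPr H1 H2.
  + by rewrite mulr0 !diffop0l diffop0r.
- by rewrite mulrDl -scalerAl !diffopPl H1 H2.
by rewrite mul0r !diffop0l.
Qed.

(** The chain rule.  Both sides are multiplicative in the operator, and for an
    operator of order one the Leibniz rule holds on both sides, so it is enough
    to compare them for a partial derivative of a variable. *)
Lemma diffop_precomp A D p :
  diffop D (precomp A p) = precomp A (diffop (precomp A^T D) p).
Proof.
elim/mpoly_ind_alg: D p => [c|i|D E HD HE|D E HD HE] p.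
- by rewrite precompC !diffopC precompZ.
- rewrite diffopX mderivmU1m precompX diffop_suml.
  under eq_bigr do rewrite mxE diffopZl diffopX mderivmU1m.
  rewrite precomp_sum; under eq_bigr do rewrite precompZ.
  elim/mpoly_ind_alg: p => [c|k|p q Hp Hq|p q Hp Hq].
  + rewrite precompC mderivC big1 // => j _.
    by rewrite mderivC precomp0 scaler0.
  + have dX (j l : 'I_n) : ('X_l : {mpoly C[n]})^`M(j) = (l == j)%:R%:MP.
      rewrite mderivX mnm1E; case: eqP => [->|_]; last by rewrite scale0r.
      have -> : (U_(j) - U_(j) = 0 :> 'X_{1..n})%MM.
        by apply/mnmP => x; rewrite mnmBE subnn mnm0E.
      by rewrite scale1r mpolyX0.
    rewrite precompX [RHS](bigD1 k) //= dX eqxx precompC.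
    rewrite [X in _ = _ + X]big1 ?addr0 => [|j jk]; last first.
      by rewrite dX eq_sym (negPf jk) precompC scaler0.
    rewrite raddf_sum (bigD1 i) //= big1 ?addr0 => [|j ji].
      by rewrite mderivZ dX eqxx.
    by rewrite mderivZ dX (negPf ji) scaler0.
  + rewrite precompD mderivD Hp Hq -big_split /=; apply: eq_bigr => j _.
    by rewrite mderivD precompD scalerDr.
  + rewrite precompM mderivM Hp Hq mulr_suml mulr_sumr -big_split /=.
    apply: eq_bigr => j _.
    by rewrite mderivM precompD !precompM scalerDr scalerAl scalerAr.
- by rewrite precompD !diffopDl precompD HD HE.
- by rewrite precompM !diffopM HE HD.
Qed.

(** The apolar pairing of S(V), as constant-coefficient operators, with
    S(V^* ).  Monomials are orthogonal for it ([apolarX]), so it is symmetric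
    and compatible with every grading by weights of the coordinates. *)
Definition apolar D p : C := (diffop D p)@_0%MM.

Lemma apolarPl c D E p : apolar (c *: D + E) p = c * apolar D p + apolar E p.
Proof. by rewrite /apolar diffopPl mcoeffD mcoeffZ. Qed.

Lemma apolarPr D c p q : apolar D (c *: p + q) = c * apolar D p + apolar D q.
Proof. by rewrite /apolar diffopPr mcoeffD mcoeffZ. Qed.

Lemma apolarM D E p : apolar (D * E) p = apolar D (diffop E p).
Proof. by rewrite /apolar diffopM. Qed.

Lemma apolar_precomp A D p : apolar D (precomp A p) = apolar (precomp A^T D) p.
Proof. by rewrite /apolar diffop_precomp mcoeff0_precomp. Qed.

Definition mfact (m : 'X_{1..n}) : nat := (\prod_(i < n) (m i)`!)%N.

Lemma apolarE D p : apolar D p = \sum_(m <- msupp D) D@_m * p@_m *+ mfact m.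
Proof.
rewrite /apolar /diffop raddf_sum /=; apply: eq_bigr => m _.
rewrite mcoeffZ mcoeff_mderivm addm0 -mulrnAr; congr (_ * (_ *+ _)).
by apply: eq_bigr => i _; rewrite ffactnn.
Qed.

Lemma apolarX m p : apolar 'X_[m] p = p@_m *+ mfact m.
Proof. by rewrite apolarE msuppX big_seq1 mcoeffX eqxx mul1r. Qed.

Lemma mfact_gt0 m : (0 < mfact m)%N.
Proof. by apply: prodn_gt0 => i; apply: fact_gt0. Qed.

Lemma apolar_pihomog (mf : measure n) d D p :
  apolar (pihomog mf d D) p = apolar D (pihomog mf d p).
Proof.
elim/mpoly_ind_lin: D => [m|c D E HD HE|].
- rewrite apolarX mcoeff_pihomog pihomogX; case: ifP => _.
    by rewrite apolarX.
  by rewrite /apolar diffop0l mcoeff0 mul0rn.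
- by rewrite linearP /= !apolarPl HD HE.
by rewrite linear0 /apolar !diffop0l.
Qed.

End Diffop.

Section ApolarForm.
Variables (C : numClosedFieldType) (n : nat).
Implicit Types (A : 'M[C]_n) (D E p q : {mpoly C[n]}).

Lemma mfact_neq0 (m : 'X_{1..n}) : (mfact m)%:R != 0 :> C.
Proof. by rewrite pnatr_eq0 -lt0n mfact_gt0. Qed.

Lemma apolar_nondegr p : (forall D, apolar D p = 0) -> p = 0.
Proof.
move=> p0; apply/mpolyP => m; have /eqP := p0 'X_[m].
by rewrite mcoeff0 apolarX -mulr_natr mulf_eq0 (negPf (mfact_neq0 m)) orbF => /eqP.
Qed.

Lemma apolarC D p : apolar D p = apolar p D.
Proof.
elim/mpoly_ind_lin: D => [m|c D E HD HE|].
- elim/mpoly_ind_lin: p => [m'|c p q Hp Hq|].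
  + rewrite !apolarX !mcoeffX eq_sym; case: eqP => [->//|].
    by rewrite !mul0rn.
  + by rewrite apolarPl apolarPr Hp Hq.
  + by rewrite /apolar diffop0l diffop0r.
- by rewrite apolarPl apolarPr HD HE.
by rewrite /apolar diffop0l diffop0r.
Qed.

Lemma diffop_inj D E : (forall p, diffop D p = diffop E p) -> D = E.
Proof.
move=> DE; apply/eqP; rewrite -subr_eq0; apply/eqP.
apply: apolar_nondegr => p; rewrite apolarC.
rewrite -[D - E]addrC -scaleN1r apolarPl /apolar DE.
by rewrite mulN1r addNr.
Qed.

Definition cpoly p : {mpoly C[n]} := map_mpoly Num.conj p.

Lemma cpolyD p q : cpoly (p + q) = cpoly p + cpoly q.
Proof. by rewrite /cpoly rmorphD. Qed.

Lemma cpolyM p q : cpoly (p * q) = cpoly p * cpoly q.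
Proof. by rewrite /cpoly rmorphM. Qed.

Lemma cpolyZ c p : cpoly (c *: p) = c^* *: cpoly p.
Proof. by rewrite /cpoly map_mpolyZ. Qed.

Lemma mcoeff_cpoly p m : (cpoly p)@_m = (p@_m)^*.
Proof. exact: mcoeff_map_mpoly. Qed.

Lemma cpolyK : involutive cpoly.
Proof. by move=> p; apply/mpolyP => m; rewrite !mcoeff_cpoly conjCK. Qed.

Lemma cpoly_pihomog (mf : measure n) d p :
  cpoly (pihomog mf d p) = pihomog mf d (cpoly p).
Proof.
apply/mpolyP => m; rewrite mcoeff_cpoly !mcoeff_pihomog mcoeff_cpoly.
by case: ifP; rewrite ?conjC0.
Qed.

Lemma cpoly_precomp A p : cpoly (precomp A p) = precomp (map_mx Num.conj A) (cpoly p).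
Proof.
rewrite /cpoly /precomp map_mpoly_comp; last exact: (inv_inj (@conjCK C)).
congr (_ \mPo _); apply: eq_from_tnth => i; rewrite tnth_map !tnth_mktuple.
rewrite raddf_sum; apply: eq_bigr => j _.
by rewrite /= map_mpolyZ map_mpolyX mxE.
Qed.

Lemma apolar_cpoly D p : apolar (cpoly D) (cpoly p) = (apolar D p)^*.
Proof.
elim/mpoly_ind_lin: D => [m|c D E HD HE|].
- have -> : cpoly 'X_[m] = 'X_[m] by rewrite /cpoly map_mpolyX.
  by rewrite !apolarX mcoeff_cpoly rmorphMn.
- by rewrite cpolyD cpolyZ !apolarPl HD HE rmorphD rmorphM.
rewrite /apolar !diffop0l mcoeff0 conjC0.
by rewrite /cpoly raddf0 diffop0l mcoeff0.
Qed.

Lemma apolar_pos p : apolar (cpoly p) p = 0 -> p = 0.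
Proof.
move=> p0; apply/mpolyP => m; rewrite mcoeff0.
have [mp|/memN_msupp_eq0//] := boolP (m \in msupp p).
have /eqP : \sum_(k <- msupp p) `|p@_k| ^+ 2 *+ mfact k = 0.
  rewrite -[RHS]p0 apolarC apolarE; apply: eq_bigr => k _.
  by rewrite mcoeff_cpoly normCK.
rewrite psumr_eq0 => [/allP/(_ m mp)|k _]; last first.
  by rewrite mulrn_wge0 // exprn_ge0.
rewrite -mulr_natr mulf_eq0 (negPf (mfact_neq0 m)) orbF.
by rewrite expf_eq0 /= normr_eq0 => /eqP.
Qed.

End ApolarForm.

(** * Averaging a linear group into a unitary one *)

Section Unitarization.
Variables (C : numClosedFieldType) (gT : finGroupType) (K : {group gT}) (n : nat).
Variable rho : mx_representation C K n.

Lemma gram_diagE m k (A : 'M[C]_(m, k)) i :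
  (A *m map_mx Num.conj A^T) i i = \sum_j `|A i j| ^+ 2.
Proof. by rewrite mxE; apply: eq_bigr => j _; rewrite !mxE normCK. Qed.

Definition gram_sum : 'M[C]_n := \sum_(h in K) rho h *m map_mx Num.conj (rho h)^T.

(** The sum of the A A^* over the group is positive definite, so that the
    spectral theorem provides a square root of it. *)
Lemma gram_sum_root :
  exists2 B : 'M[C]_n, B \in unitmx & B *m map_mx Num.conj B^T = gram_sum.
Proof.
set Q := gram_sum.
have Qherm : Q \is hermsymmx.
  apply/is_hermitianmxP; rewrite expr0 scale1r /Q /gram_sum.
  rewrite !raddf_sum /=; apply: eq_bigr => h _.
  rewrite trmx_mul map_mxM; congr (_ *m _).
  by apply/matrixP => i j; rewrite !mxE /= conjCK.
have /orthomx_spectralP DQ := hermitian_normalmx Qherm.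
have uP := spectral_unitarymx Q; have unP := spectral_unit Q.
set P := spectralmx Q in DQ uP unP; set d := spectral_diag Q in DQ.
have PP : P *m map_mx Num.conj P^T = 1%:M by apply/unitarymxP.
have Dd : P *m Q *m map_mx Num.conj P^T = diag_mx d.
  by rewrite DQ !mulmxA mulmxV // mul1mx -mulmxA PP mulmx1.
have d_gt0 i : 0 < d 0 i.
  have -> : d 0 i = (P *m Q *m map_mx Num.conj P^T) i i.
    by rewrite Dd mxE eqxx.
  (* The term of the unit element is 1, the others are sums of squares. *)
  rewrite /Q /gram_sum mulmx_sumr mulmx_suml summxE (bigD1 1%g) //=.
  rewrite repr_mx1 mul1mx trmx1 map_mx1 mulmx1 PP mxE eqxx.
  rewrite ltr_pwDl ?ltr01 // sumr_ge0 // => h _.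
  rewrite mulmxA -mulmxA -map_mxM -trmx_mul gram_diagE sumr_ge0 // => j _.
  by rewrite exprn_ge0.
pose s : 'rV[C]_n := \row_i sqrtC (d 0 i).
have s_gt0 i : 0 < s 0 i by rewrite mxE sqrtC_gt0.
have s_sqr i : s 0 i ^+ 2 = d 0 i by rewrite mxE sqrtCK.
clearbody s.
exists (map_mx Num.conj P^T *m diag_mx s).
  rewrite unitmx_mul -(invmx_unitary uP) unitmx_inv unP.
  rewrite unitmxE det_diag unitfE; apply/prodf_neq0 => i _.
  by rewrite lt0r_neq0.
rewrite trmx_mul map_mxM tr_diag_mx map_diag_mx -mulmxA.
have -> : map_mx Num.conj (map_mx Num.conj P^T)^T = P.
  by apply/matrixP => i j; rewrite !mxE /= conjCK.
rewrite (mulmxA (diag_mx s)) mulmx_diag [RHS]DQ (invmx_unitary uP) mulmxA.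
congr (_ *m diag_mx _ *m _); apply/rowP => i.
rewrite [LHS]mxE [(map_mx _ _) 0 i]mxE /= (conj_Creal (gtr0_real (s_gt0 i))).
by rewrite -expr2 s_sqr.
Qed.

Lemma gram_sum_invariant g : g \in K ->
  rho g *m gram_sum *m map_mx Num.conj (rho g)^T = gram_sum.
Proof.
move=> Kg; rewrite /gram_sum mulmx_sumr mulmx_suml.
rewrite [RHS](reindex_inj (mulgI g)) /=.
apply: eq_big => [h|h Kh]; first by rewrite groupMl.
by rewrite repr_mxM // trmx_mul map_mxM !mulmxA.
Qed.

End Unitarization.

(** * Harmonic polynomials form a complement of the Hilbert ideal *)

Section PairSpan.
Variables (C : fieldType) (n k : nat).
Variable mul : {mpoly C[n]} -> {mpoly C[n]} -> {mpoly C[k]}.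
Implicit Types (U W : {mpoly C[n]} -> Prop) (t : {mpoly C[k]}).

Definition pair_span U W t : Prop :=
  exists2 s : seq ({mpoly C[n]} * {mpoly C[n]}),
    forall p, p \in s -> U p.1 /\ W p.2
  & t = \sum_(p <- s) mul p.1 p.2.

Lemma pair_span0 U W : pair_span U W 0.
Proof. by exists [::] => //; rewrite big_nil. Qed.

Lemma pair_spanD U W t t' :
  pair_span U W t -> pair_span U W t' -> pair_span U W (t + t').
Proof.
case=> s Hs -> [s' Hs' ->]; exists (s ++ s'); last by rewrite big_cat.
by move=> p; rewrite mem_cat => /orP[/Hs|/Hs'].
Qed.

Lemma mem_pair_span U W u w : U u -> W w -> pair_span U W (mul u w).
Proof.
move=> Uu Ww; exists [:: (u, w)]; last by rewrite big_seq1.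
by move=> p; rewrite inE => /eqP->.
Qed.

Lemma pair_span_ind U W (P : {mpoly C[k]} -> Prop) :
    P 0 -> (forall t t', P t -> P t' -> P (t + t')) ->
    (forall u w, U u -> W w -> P (mul u w)) ->
  forall t, pair_span U W t -> P t.
Proof.
move=> P0 PD Pm t [s Hs ->]; elim: s Hs => [|p s IHs] Hs.
  by rewrite big_nil.
rewrite big_cons; apply: PD.
  by have [] := Hs p (mem_head _ _); apply: Pm.
by apply: IHs => q qs; apply: Hs; rewrite inE qs orbT.
Qed.

Lemma pair_span_subspace U W :
    subspace U -> (forall c u w, mul (c *: u) w = c *: mul u w) ->
  subspace (pair_span U W).
Proof.
move=> sU mulZ; split=> [|c t t' Ht Ht']; first exact: pair_span0.
apply: pair_spanD Ht'; elim/pair_span_ind: Ht => [|t1 t2 H1 H2|u w Uu Ww].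
- by rewrite scaler0; apply: pair_span0.
- by rewrite scalerDr; apply: pair_spanD.
- by rewrite -mulZ; apply: mem_pair_span => //; apply: subspaceZ.
Qed.

End PairSpan.

Section Action.
Variables (C : fieldType) (gT : finGroupType) (n : nat).
Implicit Types (g h : gT) (p q : {mpoly C[n]}).

Section Raw.
Variable rho : gT -> 'M[C]_n.

Lemma poly_actD g p q : poly_act rho g (p + q) = poly_act rho g p + poly_act rho g q.
Proof. exact: precompD. Qed.

Lemma poly_actB g p q : poly_act rho g (p - q) = poly_act rho g p - poly_act rho g q.
Proof. exact: precompB. Qed.

Lemma poly_actZ g c p : poly_act rho g (c *: p) = c *: poly_act rho g p.
Proof. exact: precompZ. Qed.

Lemma poly_actM g p q : poly_act rho g (p * q) = poly_act rho g p * poly_act rho g q.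
Proof. exact: precompM. Qed.

Lemma poly_act0 g : poly_act rho g 0 = 0.
Proof. exact: precomp0. Qed.

Lemma poly_actC g c : poly_act rho g c%:MP = c%:MP.
Proof. exact: precompC. Qed.

Lemma poly_act_sum g (I : Type) (s : seq I) (P : pred I) (E : I -> {mpoly C[n]}) :
  poly_act rho g (\sum_(i <- s | P i) E i) = \sum_(i <- s | P i) poly_act rho g (E i).
Proof. exact: precomp_sum. Qed.

Lemma poly_invariant_subspace (A : {set gT}) : subspace (poly_invariant rho A).
Proof.
split=> [g _|c p q Hp Hq g Ag]; first exact: poly_act0.
by rewrite poly_actD poly_actZ Hp // Hq.
Qed.

Lemma poly_invariantM (A : {set gT}) p q :
  poly_invariant rho A p -> poly_invariant rho A q -> poly_invariant rho A (p * q).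
Proof. by move=> Hp Hq g Ag; rewrite poly_actM Hp // Hq. Qed.

Lemma poly_invariantC (A : {set gT}) c : poly_invariant rho A c%:MP.
Proof. by move=> g _; rewrite poly_actC. Qed.

Definition positive_invariant (A : {set gT}) q : Prop :=
  poly_invariant rho A q /\ q@_0%MM = 0.

Definition hilbert_ideal (A : {set gT}) : {mpoly C[n]} -> Prop :=
  pair_span *%R (fun=> True) (positive_invariant A).

Lemma hilbert_ideal_subspace A : subspace (hilbert_ideal A).
Proof. by apply: pair_span_subspace => // c u w; rewrite scalerAl. Qed.

Lemma hilbert_idealM A p q : hilbert_ideal A q -> hilbert_ideal A (p * q).
Proof.
elim/pair_span_ind => [|q1 q2 H1 H2|u w _ Hw].
- by rewrite mulr0; apply: pair_span0.
- by rewrite mulrDr; apply: pair_spanD.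
by rewrite mulrA; apply: mem_pair_span.
Qed.

Lemma positive_invariant_ideal A q : positive_invariant A q -> hilbert_ideal A q.
Proof. by move=> Hq; rewrite -[q]mul1r; apply: mem_pair_span. Qed.

(** Block diagonality along the level sets of w: this makes the action commute
    with the projections to the w-homogeneous components.  The constant weight
    1 gives the usual degree. *)
Definition weight_preserving (A : {set gT}) (w : 'I_n -> nat) : Prop :=
  forall g, g \in A -> forall i j, rho g i j != 0 -> w i = w j.

End Raw.

Variables (K : {group gT}) (rho : mx_representation C K n).

Lemma poly_act1 p : poly_act rho 1%g p = p.
Proof. by rewrite /poly_act invg1 repr_mx1 precomp1. Qed.

Lemma poly_act_comp g h p : g \in K -> h \in K ->
  poly_act rho g (poly_act rho h p) = poly_act rho (g * h)%g p.
Proof.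
by move=> Kg Kh; rewrite /poly_act precomp_comp invMg repr_mxM ?groupV.
Qed.

Lemma poly_actK g : g \in K -> cancel (poly_act rho g) (poly_act rho g^-1%g).
Proof. by move=> Kg p; rewrite poly_act_comp ?groupV // mulVg poly_act1. Qed.

Lemma poly_actKV g : g \in K -> cancel (poly_act rho g^-1%g) (poly_act rho g).
Proof. by move=> Kg p; rewrite poly_act_comp ?groupV // mulgV poly_act1. Qed.

Lemma poly_act_inj g : g \in K -> injective (poly_act rho g).
Proof. by move=> Kg; apply: can_inj (poly_actK Kg). Qed.

Lemma pihomog_poly_act (w : 'I_n -> nat) g d p :
    weight_preserving rho K w -> g \in K ->
  pihomog (wdeg w) d (poly_act rho g p) = poly_act rho g (pihomog (wdeg w) d p).
Proof. by move=> wp Kg; apply: wpihomog_precomp; apply: wp; rewrite groupV. Qed.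

Lemma poly_invariant_pihomog (w : 'I_n -> nat) d p :
    weight_preserving rho K w -> poly_invariant rho K p ->
  poly_invariant rho K (pihomog (wdeg w) d p).
Proof. by move=> wp Hp g Kg; rewrite -pihomog_poly_act // Hp. Qed.

Lemma hilbert_ideal_pihomog (w : 'I_n -> nat) d p :
    weight_preserving rho K w -> hilbert_ideal rho K p ->
  hilbert_ideal rho K (pihomog (wdeg w) d p).
Proof.
move=> wp; elim/pair_span_ind => [|q1 q2 H1 H2|u v _ [Hv v0]].
- by rewrite linear0; apply: pair_span0.
- by rewrite linearD; apply: pair_spanD.
rewrite pihomogM; apply: subspace_sum (hilbert_ideal_subspace _ _) _ => e _.
apply: mem_pair_span => //; split; first exact: poly_invariant_pihomog.
by rewrite mcoeff_pihomog v0 if_same.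
Qed.

(** The Reynolds operator without its factor 1 / #|K|, which neither
    invariance nor linearity over the invariants involves. *)
Definition reynolds p : {mpoly C[n]} := \sum_(g in K) poly_act rho g p.

Lemma reynolds_invariant p : poly_invariant rho K (reynolds p).
Proof.
move=> g Kg; rewrite /reynolds poly_act_sum [RHS](reindex_inj (mulgI g)) /=.
apply: eq_big => [h|h Kh]; first by rewrite groupMl.
by rewrite poly_act_comp.
Qed.

Lemma reynoldsM p q : poly_invariant rho K q -> reynolds (p * q) = reynolds p * q.
Proof.
move=> Hq; rewrite /reynolds mulr_suml; apply: eq_bigr => g Kg.
by rewrite poly_actM Hq.
Qed.

End Action.

Lemma pihomog_mdeg (C : fieldType) n d (p : {mpoly C[n]}) :
  pihomog mdeg d p = pihomog (wdeg (fun=> 1%N)) d p.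
Proof.
apply/mpolyP => m; rewrite !mcoeff_pihomog /=.
by rewrite mdegE /wdeg; under [in RHS]eq_bigr do rewrite muln1.
Qed.

Lemma weight_preserving1 (C : fieldType) (gT : finGroupType) n
  (rho : gT -> 'M[C]_n) A : weight_preserving rho A (fun=> 1%N).
Proof. by []. Qed.

Section Harmonic.
Variables (C : numClosedFieldType) (gT : finGroupType) (n : nat).
Variables (K : {group gT}) (rho : mx_representation C K n).
Implicit Types (g h : gT) (D E p q : {mpoly C[n]}).

Lemma is_harmonic_subspace (A : {set gT}) : subspace (is_harmonic rho A).
Proof.
split=> [D _ _|c p q Hp Hq D D0 Dinv]; first exact: diffop0r.
by rewrite diffopPr Hp // Hq // scaler0 addr0.
Qed.

Lemma is_harmonic1 (A : {set gT}) : is_harmonic rho A 1.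
Proof.
move=> D D0 _; rewrite /diffop big1_seq // => m /andP[_ mD].
have nz : m != 0%MM.
  by apply: contraTneq mD => ->; rewrite mcoeff_msupp D0 eqxx.
rewrite -mpolyX0; apply/eqP; rewrite mderivmX scaler_eq0 scaler_eq0.
have [i mi] : exists i, m i != 0%N.
  apply/existsP; apply: contraR nz; rewrite negb_exists => /forallP m0.
  by apply/eqP/mnmP => i; rewrite mnm0E; apply/eqP/negPn/m0.
rewrite (bigD1 i) //= mnm0E ffact_small ?lt0n // mul0n.
by rewrite eqxx orbT.
Qed.

Lemma invariant_diffopP D :
  invariant_diffop rho K D <-> forall g, g \in K -> precomp (rho g)^T D = D.
Proof.
split=> [Dinv g Kg|Dinv g Kg p]; last first.
  by rewrite /poly_act diffop_precomp Dinv // groupV.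
have Kg' : g^-1%g \in K by rewrite groupV.
apply: diffop_inj => p; apply: (poly_act_inj (rho := rho) Kg').
by rewrite -Dinv // /poly_act invgK diffop_precomp.
Qed.

Let P : 'M[C]_n := map_mx Num.conj (gram_sum rho).

Lemma gram_conj_root : exists2 B : 'M[C]_n, B \in unitmx & P = map_mx Num.conj B *m B^T.
Proof.
have [B uB DB] := gram_sum_root rho; exists B => //.
rewrite /P -DB map_mxM; congr (_ *m _).
by apply/matrixP => i j; rewrite !mxE /= conjCK.
Qed.

Lemma gram_conj_unit : P \in unitmx.
Proof.
have [B uB ->] := gram_conj_root.
by rewrite unitmx_mul map_unitmx unitmx_tr uB.
Qed.

(** The semilinear algebra isomorphism from S(V^* ) to S(V) induced by the
    K-invariant Hermitian form with matrix gram_sum. *)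
Definition to_operator p : {mpoly C[n]} := precomp P (cpoly p).

Definition herm p q : C := apolar (to_operator p) q.

Lemma to_operatorM p q : to_operator (p * q) = to_operator p * to_operator q.
Proof. by rewrite /to_operator cpolyM precompM. Qed.

Lemma to_operator_surj D : to_operator (cpoly (precomp (invmx P) D)) = D.
Proof. by rewrite /to_operator cpolyK precompVK // gram_conj_unit. Qed.

Lemma to_operator_inj : injective to_operator.
Proof.
move=> p q /(can_inj (precompK gram_conj_unit)).
exact: (can_inj (@cpolyK C n)).
Qed.

Lemma to_operator_act g p : g \in K ->
  precomp (rho g)^T (to_operator p) = to_operator (poly_act rho g p).
Proof.
move=> Kg.
have := congr1 (mulmx (rho g^-1%g)) (gram_sum_invariant rho Kg).
have Kg' : g^-1%g \in K by rewrite groupV.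
rewrite !mulmxA -(repr_mxM rho Kg' Kg) mulVg repr_mx1 mul1mx => DS.
have DP : P *m (rho g)^T = map_mx Num.conj (rho g^-1%g) *m P.
  rewrite /P -map_mxM -DS map_mxM; congr (_ *m _).
  by apply/matrixP => i j; rewrite !mxE /= conjCK.
by rewrite /to_operator /poly_act cpoly_precomp !precomp_comp DP.
Qed.

Lemma to_operator_invariant q :
  invariant_diffop rho K (to_operator q) <-> poly_invariant rho K q.
Proof.
split=> [/invariant_diffopP Hq g Kg|Hq]; last first.
  by apply/invariant_diffopP => g Kg; rewrite (to_operator_act q Kg) (Hq g Kg).
by apply: to_operator_inj; rewrite -(to_operator_act q Kg) (Hq g Kg).
Qed.

Lemma mcoeff0_to_operator p : (to_operator p)@_0%MM = (p@_0%MM)^*.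
Proof. by rewrite mcoeff0_precomp mcoeff_cpoly. Qed.

Lemma hermE : exists2 B : 'M[C]_n, B \in unitmx &
  forall p q, herm p q = apolar (cpoly (precomp B p)) (precomp B q).
Proof.
have [B uB DP] := gram_conj_root; exists B => // p q.
by rewrite apolar_precomp cpoly_precomp precomp_comp -DP.
Qed.

Lemma herm_linear p c q r : herm p (c *: q + r) = c * herm p q + herm p r.
Proof. exact: apolarPr. Qed.

Lemma herm_sym p q : herm p q = (herm q p)^*.
Proof.
have [B _ DB] := hermE.
by rewrite !DB -apolar_cpoly cpolyK apolarC.
Qed.

Lemma herm_pos p : herm p p = 0 -> p = 0.
Proof.
have [B uB ->] := hermE => /apolar_pos H.
by rewrite -(precompK uB p) H precomp0.
Qed.

Lemma herm_pihomog (w : 'I_n -> nat) d p q : weight_preserving rho K w ->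
  herm (pihomog (wdeg w) d p) q = herm p (pihomog (wdeg w) d q).
Proof.
move=> wp; rewrite /herm -apolar_pihomog; congr apolar.
rewrite /to_operator cpoly_pihomog wpihomog_precomp // => i j.
apply: contraNeq => wij; rewrite mxE /gram_sum summxE big1 ?conjC0 // => g Kg.
rewrite mxE big1 // => k _; rewrite !mxE.
have [->|nzi] := eqVneq (rho g i k) 0; first by rewrite mul0r.
have [->|nzj] := eqVneq (rho g j k) 0; first by rewrite /= conjC0 mulr0.
by case/eqP: wij; rewrite (wp g Kg i k nzi) (wp g Kg j k nzj).
Qed.

Lemma herm0r p : herm p 0 = 0.
Proof. by rewrite /herm /apolar diffop0r mcoeff0. Qed.

Lemma herm0l p : herm 0 p = 0.
Proof. by rewrite herm_sym herm0r conjC0. Qed.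

Lemma hermDl p q r : herm (p + q) r = herm p r + herm q r.
Proof.
rewrite herm_sym (herm_sym p) (herm_sym q) -rmorphD; congr (_^*).
by rewrite -[X in X + q]scale1r herm_linear mul1r.
Qed.

(** Multiplication by q is adjoint to the operator to_operator q, and these
    operators are the invariant ones exactly when q is invariant.  As the form
    is nondegenerate, p is killed by all of them when it is orthogonal to all
    the multiples of the q. *)
Lemma harmonicP p :
  is_harmonic rho K p <-> forall q, hilbert_ideal rho K q -> herm q p = 0.
Proof.
split=> [Hp q|Hp D D0 Dinv].
  elim/pair_span_ind => [|q1 q2 H1 H2|u v _ [Hv v0]].
  - exact: herm0l.
  - by rewrite hermDl H1 H2 addr0.
  rewrite /herm to_operatorM apolarM Hp ?mcoeff0_to_operator ?v0 ?conjC0 //.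
    by rewrite /apolar diffop0r mcoeff0.
  exact/to_operator_invariant.
pose q := cpoly (precomp (invmx P) D).
have Dq : to_operator q = D by apply: to_operator_surj.
apply: apolar_nondegr => E; rewrite -apolarM -Dq -(to_operator_surj E).
rewrite -to_operatorM; apply: Hp; apply: mem_pair_span => //; split.
  by apply/to_operator_invariant; rewrite Dq.
by apply: (can_inj (@conjCK C)); rewrite -mcoeff0_to_operator Dq D0 conjC0.
Qed.

Lemma harmonic_pihomog (w : 'I_n -> nat) d p : weight_preserving rho K w ->
  is_harmonic rho K p -> is_harmonic rho K (pihomog (wdeg w) d p).
Proof.
move=> wp /harmonicP Hp; apply/harmonicP => q Hq.
by rewrite -herm_pihomog // Hp //; apply: hilbert_ideal_pihomog.
Qed.

Lemma harmonic_ideal0 p : is_harmonic rho K p -> hilbert_ideal rho K p -> p = 0.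
Proof. by move=> /harmonicP Hp Ip; apply: herm_pos; apply: Hp. Qed.

(** Orthogonal projection in bounded degree.  Orthogonality to the elements of
    the ideal of degree less than k suffices, since the ideal is graded and
    distinct degrees are orthogonal. *)
Lemma harmonic_decomposition p :
  exists q, hilbert_ideal rho K q /\ is_harmonic rho K (p - q).
Proof.
pose k := msize p; pose W q := hilbert_ideal rho K q /\ (msize q <= k)%N.
have sI := hilbert_ideal_subspace rho K.
have sW : subspace W.
  split; first by split; [case: sI | rewrite msize0].
  move=> c u v [Iu ku] [Iv kv]; split; first by case: sI => _; apply.
  apply: leq_trans (msizeD_le _ _) _; rewrite geq_max kv andbT.
  exact: leq_trans (msizeZ_le _ _) ku.
pose es := map (fun m : 'X_{1..n < k} => 'X_[C, m]) (enum {: 'X_{1..n < k}}).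
have Wes q : W q -> in_span es q.
  case=> _ kq; rewrite (mpolywE kq); apply: subspace_sum (in_span_subspace es) _ => m _.
  apply: subspaceZ (in_span_subspace es) _.
  by apply: (in_span_mem (fun m : 'X_{1..n < k} => 'X_[C, m])); rewrite mem_enum.
have [q [[Iq kq] oq]] := orthogonal_projection herm_linear herm_sym herm_pos sW Wes p.
exists q; split=> //; apply/harmonicP => j Ij.
have kpq : (msize (p - q) <= k)%N.
  by apply: leq_trans (msizeD_le _ _) _; rewrite msizeN geq_max leqnn.
rewrite herm_sym (pihomog_partitionE kpq).
have -> : herm (\sum_(d < k) pihomog mdeg d (p - q)) j =
    \sum_(d < k) herm (pihomog mdeg d (p - q)) j.
  by apply: (big_morph (fun u => herm u j) _ (herm0l j)) => u v; apply: hermDl.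
rewrite big1 ?conjC0 // => d _.
rewrite pihomog_mdeg herm_pihomog // herm_sym -pihomog_mdeg oq ?conjC0 //.
split; first by rewrite pihomog_mdeg; apply: hilbert_ideal_pihomog.
exact: leq_trans (msize_pihomog _ _) (ltn_ord d).
Qed.

End Harmonic.

(** * Reflection groups: freeness over the invariants *)

Section Reflections.
Variables (C : numClosedFieldType) (gT : finGroupType) (n : nat).
Variables (K : {group gT}) (rho : mx_representation C K n).
Implicit Types (g h : gT) (p q : {mpoly C[n]}).

Lemma hilbert_ideal_act g p : g \in K ->
  hilbert_ideal rho K p -> hilbert_ideal rho K (poly_act rho g p).
Proof.
move=> Kg; elim/pair_span_ind => [|q1 q2 H1 H2|u v _ [Hv v0]].
- by rewrite poly_act0; apply: pair_span0.
- by rewrite poly_actD; apply: pair_spanD.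
by rewrite poly_actM Hv //; apply: mem_pair_span.
Qed.

(** A reflection is v |-> v + l(v) c for some vector c, so it changes each
    coordinate by a multiple of l.  Being invariant modulo l is stable under
    products, hence holds for all polynomials. *)
Lemma divided_difference (A : 'M[C]_n) : is_reflection A ->
  exists2 L : {mpoly C[n]}, L != 0 /\ msize L = 2%N
    & forall p, exists d, precomp A p = p + L * d.
Proof.
case=> _ _ [l nzl fixA].
have [j0 nzj0] : exists j, l 0 j != 0.
  apply/existsP; apply: contraR nzl; rewrite negb_exists => /forallP l0.
  by apply/eqP/rowP => j; rewrite mxE; apply/eqP/negPn/l0.
pose c i := (A i j0 - (i == j0)%:R) / l 0 j0.
have DA i j : A i j = (i == j)%:R + c i * l 0 j.
  pose v : 'cV[C]_n := delta_mx j 0 - (l 0 j / l 0 j0) *: delta_mx j0 0.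
  have lv : l *m v = 0.
    rewrite mulmxBr -scalemxAr -!colE; apply/matrixP => x y.
    by rewrite !ord1 !mxE divfK // subrr.
  have := congr1 (fun u : 'cV_n => u i 0) (fixA v lv).
  rewrite mulmxBr -scalemxAr -!colE !mxE !eqxx !andbT => /eqP.
  rewrite subr_eq => /eqP ->; rewrite /c; field.
  exact: nzj0.
exists (\sum_j l 0 j *: 'X_j).
  set L := \sum_j _; have nzL : L != 0.
    apply: contraNneq nzj0 => /(congr1 (mcoeff U_(j0)%MM)).
    rewrite mcoeff0 raddf_sum (bigD1 j0) //= big1 ?addr0 => [|j jj0].
      by rewrite mcoeffZ mcoeffXU eqxx mulr1 => ->.
    by rewrite mcoeffZ mcoeffXU (negPf jj0) mulr0.
  split=> //; rewrite -(mlead_deg nzL).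
  by rewrite (dhomog_mf (linear_form_dhomog (fun j => l 0 j)) (mlead_supp nzL)).
elim/mpoly_ind_alg => [a|i|p q [d1 D1] [d2 D2]|p q [d1 D1] [d2 D2]].
- by exists 0; rewrite mulr0 addr0 precompC.
- exists (c i)%:MP; rewrite precompX mulrC mul_mpolyC scaler_sumr.
  under eq_bigr do rewrite DA scalerDl -scalerA.
  rewrite big_split /= (bigD1 i) //= eqxx scale1r big1 ?addr0 // => j ji.
  by rewrite eq_sym (negPf ji) scale0r.
- by exists (d1 + d2); rewrite precompD D1 D2 mulrDr addrACA.
- exists (p * d2 + d1 * q + (\sum_j l 0 j *: 'X_j) * d1 * d2).
  by rewrite precompM D1 D2; ring.
Qed.

Hypothesis reflK : generated_by_reflections rho K.

(** Being fixed modulo a stable ideal passes from generators to the group. *)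
Lemma reflection_congruence p :
    (forall s, s \in K -> is_reflection (rho s) ->
       hilbert_ideal rho K (precomp (rho s) p - p)) ->
  forall g, g \in K -> hilbert_ideal rho K (poly_act rho g p - p).
Proof.
have sI := hilbert_ideal_subspace rho K.
move=> Hs g; have [S reflS genS] := reflK.
have SK s : s \in S -> s \in K by move=> Ss; rewrite -genS mem_gen.
rewrite -{1}genS => /gen_prodgP[k [c Sc ->]] {g}.
elim: k c Sc => [|k IHk] c Sc.
  by rewrite big_ord0 poly_act1 subrr; case: sI.
rewrite big_ord_recl; set h := (\prod_(_ < k) _)%g.
have Kh : h \in K by apply: group_prod => i _; apply/SK/Sc.
have Ss := Sc ord0; set s := c ord0 in Ss *; have Ks := SK _ Ss.
rewrite -poly_act_comp //.
rewrite -(subrK (poly_act rho s p) (poly_act rho s _)) -poly_actB -addrA.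
apply: subspaceD => //.
  by apply: hilbert_ideal_act => //; apply: IHk => i; apply: Sc.
rewrite -opprB -[in X in - (X - _)](poly_actKV rho Ks p) -poly_actB.
apply: subspaceN => //; apply: hilbert_ideal_act => //.
by rewrite /poly_act invgK; apply: Hs => //; apply: reflS.
Qed.

(** Chevalley's lemma.  The hypothesis says that Q ord0 is not in the ideal
    spanned by the others in the invariants localised at the origin, a
    condition that makes sense for inhomogeneous Q i.  A divided difference by a
    reflection turns a relation into a relation whose leading coefficient has
    smaller degree.  By induction P ord0 is thus invariant modulo the Hilbert
    ideal, hence congruent to a multiple of its average, an invariant whose
    constant term vanishes by the hypothesis. *)
Lemma chevalley k (Q : 'I_k.+1 -> {mpoly C[n]}) :
    (forall i, poly_invariant rho K (Q i)) ->
    (forall a : 'I_k.+1 -> {mpoly C[n]}, (forall i, poly_invariant rho K (a i)) ->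
       \sum_i a i * Q i = 0 -> (a ord0)@_0%MM = 0) ->
  forall P : 'I_k.+1 -> {mpoly C[n]},
    \sum_i P i * Q i = 0 -> hilbert_ideal rho K (P ord0).
Proof.
have sI := hilbert_ideal_subspace rho K.
move=> invQ Q0 P; have [d] := ubnP (msize (P ord0)).
elim: d P => // d IHd P; rewrite ltnS => szP PQ.
have [->|nzP] := eqVneq (P ord0) 0; first by case: sI.
have cong : forall g, g \in K -> hilbert_ideal rho K (poly_act rho g (P ord0) - P ord0).
  apply: reflection_congruence => s Ks refls.
  have [L [nzL szL] divL] := divided_difference refls.
  have [D DP] := choice (fun i => divL (P i)).
  rewrite DP addrC addKr; apply: hilbert_idealM; apply: IHd.
    have [->|nzD] := eqVneq (D ord0) 0.
      by rewrite msize0; case: (d) szP nzP => //; rewrite leqn0 msize_poly_eq0 => ->.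
    have : (msize (L * D ord0) <= d)%N.
      have -> : L * D ord0 = precomp (rho s) (P ord0) - P ord0.
        by rewrite DP addrC addKr.
      apply: leq_trans (msizeD_le _ _) _; rewrite msizeN geq_max szP andbT.
      exact: leq_trans (msize_precomp _ _) szP.
    by rewrite msizeM // szL.
  have := congr1 (precomp (rho s)) PQ.
  rewrite precomp_sum precomp0.
  have DPQ i : precomp (rho s) (P i * Q i) = P i * Q i + L * (D i * Q i).
    have := invQ i s^-1%g; rewrite groupV /poly_act invgK precompM DP => -> //.
    by rewrite mulrDl mulrA.
  under eq_bigr do rewrite DPQ.
  rewrite big_split /= PQ add0r -mulr_sumr => /eqP.
  by rewrite mulf_eq0 (negPf nzL) => /eqP.
have avg : reynolds rho (P ord0) - (P ord0) *+ #|K| =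
    \sum_(g in K) (poly_act rho g (P ord0) - P ord0).
  by rewrite sumrB sumr_const.
have Iavg : hilbert_ideal rho K (reynolds rho (P ord0) - P ord0 *+ #|K|).
  rewrite avg; apply: subspace_sum => // g Kg; exact: cong.
have Ireyn : hilbert_ideal rho K (reynolds rho (P ord0)).
  apply: positive_invariant_ideal; split; first exact: reynolds_invariant.
  apply: (Q0 (fun i => reynolds rho (P i))) => [i|]; first exact: reynolds_invariant.
  under eq_bigr do rewrite -reynoldsM //.
  rewrite /reynolds exchange_big big1 // => g Kg.
  by rewrite -poly_act_sum PQ poly_act0.
have : hilbert_ideal rho K (P ord0 *+ #|K|).
  have := subspaceB sI Ireyn Iavg.
  by rewrite opprB addrC subrK.
rewrite -scaler_nat => /(subspaceZ (#|K|%:R)^-1 sI).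
by rewrite scalerA mulVf ?scale1r // pnatr_eq0 -lt0n cardG_gt0.
Qed.

(** Induction on k.  By Chevalley's lemma there is an invariant relation
    between the Q i in which Q ord0 has a coefficient a ord0 not vanishing at
    the origin.  Multiplying by a ord0 eliminates Q ord0, and modulo the
    Hilbert ideal this only replaces the f i by invertible combinations. *)
Theorem independent_over_invariants k (f Q : 'I_k -> {mpoly C[n]}) :
    (forall c : 'I_k -> C, hilbert_ideal rho K (\sum_i c i *: f i) ->
       forall i, c i = 0) ->
    (forall i, poly_invariant rho K (Q i)) ->
  \sum_i f i * Q i = 0 -> forall i, Q i = 0.
Proof.
have sI := hilbert_ideal_subspace rho K.
elim: k f Q => [|k IHk] f Q indf invQ fQ; first by case.
have nI0 : ~ hilbert_ideal rho K (f ord0).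
  move=> I0; suff /(_ ord0)/eqP : forall i : 'I_k.+1, (i == ord0)%:R = 0 :> C.
    by rewrite eqxx oner_eq0.
  apply: indf; rewrite (bigD1 ord0) //= big1 ?addr0 ?scale1r // => i /negPf->.
  by rewrite scale0r.
have [a [inva aQ nz]] : exists a : 'I_k.+1 -> {mpoly C[n]},
    [/\ forall i, poly_invariant rho K (a i), \sum_i a i * Q i = 0
      & (a ord0)@_0%MM != 0].
  apply: contrapT => no; apply: nI0; apply: (chevalley invQ _ fQ) => a inva aQ.
  by apply/eqP/negPn/negP => nz; apply: no; exists a.
(* Modulo the Hilbert ideal, the a i act as their constant terms. *)
have red i p : hilbert_ideal rho K (a i * p - (a i)@_0%MM *: p).
  rewrite -mul_mpolyC -mulrBl mulrC; apply: hilbert_idealM.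
  apply: positive_invariant_ideal; split; last first.
    by rewrite mcoeffB mpolyCK subrr.
  by apply: subspaceB (poly_invariant_subspace _ _) _ _ => //;
     apply: poly_invariantC.
have Q0 j : Q (lift ord0 j) = 0.
  apply: (IHk (fun j => a ord0 * f (lift ord0 j) - a (lift ord0 j) * f ord0)
              (fun j => Q (lift ord0 j))) => // [c Ic|].
    (* Modulo the Hilbert ideal the combination by c is that of the f by c'. *)
    pose c' i := if unlift ord0 i is Some j then c j * (a ord0)@_0%MM
                 else - \sum_j c j * (a (lift ord0 j))@_0%MM.
    have c'0 : forall i, c' i = 0.
      apply: indf; rewrite big_ord_recl {1}/c' unlift_none.
      under [X in _ + X]eq_bigr do rewrite /c' liftK.
      set X := (X in hilbert_ideal _ _ X); set Y := \sum_i _ in Ic.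
      rewrite -[X](subrK Y) -opprB; apply: subspaceD => //; apply: subspaceN => //.
      rewrite /X /Y scaleNr scaler_suml opprD opprK addrA addrAC.
      rewrite -sumrB -big_split /=; apply: subspace_sum => // i _.
      have -> : c i *: (a ord0 * f (lift ord0 i) - a (lift ord0 i) * f ord0)
           - (c i * (a ord0)@_0%MM) *: f (lift ord0 i)
           + (c i * (a (lift ord0 i))@_0%MM) *: f ord0 =
         c i *: ((a ord0 * f (lift ord0 i) - (a ord0)@_0%MM *: f (lift ord0 i)) -
                 (a (lift ord0 i) * f ord0 - (a (lift ord0 i))@_0%MM *: f ord0)).
        rewrite -!scalerA -scalerBr -scalerDr opprB [in RHS]addrA [in RHS]addrAC.
        by congr (_ *: (_ + _)); apply: addrAC.
      by apply: subspaceZ => //; apply: subspaceB.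
    move=> i; have := c'0 (lift ord0 i); rewrite /c' liftK => /eqP.
    by rewrite mulf_eq0 (negPf nz) orbF => /eqP.
  under eq_bigr do rewrite mulrBl -!mulrA [f ord0 * _]mulrC (mulrA (a (lift _ _))).
  rewrite sumrB -mulr_sumr -mulr_suml.
  move/eqP: aQ; rewrite big_ord_recl addrC addr_eq0 => /eqP ->.
  move/eqP: fQ; rewrite big_ord_recl addrC addr_eq0 => /eqP ->.
  by ring.
move=> i; case: (unliftP ord0 i) => [j ->|->]; first exact: Q0.
move: fQ; rewrite big_ord_recl big1 ?addr0 => [/eqP|j _]; last by rewrite Q0 mulr0.
rewrite mulf_eq0 => /orP[/eqP f0|/eqP //].
by case: nI0; rewrite f0; case: sI.
Qed.

End Reflections.

Section Generation.
Variables (C : numClosedFieldType) (gT : finGroupType) (n : nat).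
Variables (K : {group gT}) (rho : mx_representation C K n).

Let M := pair_span *%R (poly_invariant rho K) (is_harmonic rho K).

Lemma harmonic_span_subspace : subspace M.
Proof.
apply: pair_span_subspace; first exact: poly_invariant_subspace.
by move=> c u w; rewrite scalerAl.
Qed.

Lemma harmonic_spanM p q : poly_invariant rho K p -> M q -> M (p * q).
Proof.
move=> Hp; elim/pair_span_ind => [|q1 q2 H1 H2|u v Hu Hv].
- by rewrite mulr0; apply: pair_span0.
- by rewrite mulrDr; apply: pair_spanD.
by rewrite mulrA; apply: mem_pair_span => //; apply: poly_invariantM.
Qed.

(** A graded form of Nakayama's lemma: a homogeneous element is harmonic modulo
    the Hilbert ideal, and the coefficients of the elements of that ideal have
    smaller degree, so they are in the span by induction. *)
Lemma harmonic_span_full p : M p.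
Proof.
have sM := harmonic_span_subspace.
suff Md d : forall q, M (pihomog mdeg d q).
  rewrite (pihomog_partitionE (leqnn (msize p))).
  by apply: subspace_sum => // d _.
elim/ltn_ind: d => d IHd {}p.
have [j [Ij Hj]] := harmonic_decomposition rho p.
rewrite -(subrK j p) linearD /=; apply: subspaceD => //.
  rewrite -[pihomog _ _ _]mul1r pihomog_mdeg; apply: mem_pair_span.
    by rewrite -mpolyC1; apply: poly_invariantC.
  exact: harmonic_pihomog.
elim/pair_span_ind: Ij => [|q1 q2 H1 H2|u v _ [Hv v0]].
- by rewrite linear0; case: sM.
- by rewrite linearD; apply: subspaceD.
rewrite pihomogM; apply: subspace_sum => // e _.
have [ed|de] := ltnP e d.
  rewrite mulrC; apply: harmonic_spanM (IHd _ ed _).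
  by rewrite pihomog_mdeg; apply: poly_invariant_pihomog.
have -> : (d - e = 0)%N by apply/eqP; rewrite subn_eq0.
by rewrite pihomog0_coef v0 mpolyC0 mulr0; case: sM.
Qed.

End Generation.

(** * Tensor products *)

Section Tensors.
Variables (C : fieldType) (n : nat).
Implicit Types (p q f : {mpoly C[n]}) (t : {mpoly C[n + n]}).

Lemma tensDl p q f : tens (p + q) f = tens p f + tens q f.
Proof. by rewrite /tens comp_mpolyD mulrDl. Qed.

Lemma tensZl c p f : tens (c *: p) f = c *: tens p f.
Proof. by rewrite /tens comp_mpolyZ scalerAl. Qed.

Lemma tensDr f p q : tens f (p + q) = tens f p + tens f q.
Proof. by rewrite /tens comp_mpolyD mulrDr. Qed.

Lemma tensZr f c p : tens f (c *: p) = c *: tens f p.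
Proof. by rewrite /tens comp_mpolyZ scalerAr. Qed.

(** Restriction of functions on V + V to the diagonal, that is, the
    multiplication map of S(V^* ). *)
Definition diagonal t : {mpoly C[n]} :=
  t \mPo [tuple 'X_(match split i with inl j => j | inr j => j end) | i < n + n].

Lemma diagonalP c s t : diagonal (c *: s + t) = c *: diagonal s + diagonal t.
Proof. by rewrite /diagonal linearP. Qed.

Lemma diagonal_tens p q : diagonal (tens p q) = p * q.
Proof.
rewrite /diagonal /tens rmorphM /=; congr (_ * _).
  elim/mpoly_ind_alg: p => [c|i|p p' Hp Hp'|p p' Hp Hp'].
  - by rewrite !comp_mpolyC.
  - rewrite comp_mpolyXU -tnth_nth tnth_mktuple comp_mpolyXU -tnth_nth tnth_mktuple.
    by rewrite (unsplitK (inl i)).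
  - by rewrite !comp_mpolyD Hp Hp'.
  - by rewrite !rmorphM /= Hp Hp'.
elim/mpoly_ind_alg: q => [c|i|p' p'' Hp Hp'|p' p'' Hp Hp'].
- by rewrite !comp_mpolyC.
- rewrite comp_mpolyXU -tnth_nth tnth_mktuple comp_mpolyXU -tnth_nth tnth_mktuple.
  by rewrite (unsplitK (inr i)).
- by rewrite !comp_mpolyD Hp Hp'.
- by rewrite !rmorphM /= Hp Hp'.
Qed.

Lemma pihomog_diagonal d t :
  pihomog mdeg d (diagonal t) = diagonal (pihomog mdeg d t).
Proof. by apply: pihomog_comp => i; rewrite tnth_mktuple dhomogX /= !mdeg1. Qed.

Lemma pihomog_tens d p q :
  pihomog mdeg d (tens p q) =
  \sum_(e < d.+1) tens (pihomog mdeg e p) (pihomog mdeg (d - e) q).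
Proof.
rewrite /tens pihomogM; apply: eq_bigr => e _.
by congr (_ * _); apply: pihomog_comp => i; rewrite tnth_mktuple dhomogX /= !mdeg1.
Qed.

Lemma poly_act_tens (gT : finGroupType) (rho : gT -> 'M[C]_n) g p q :
  poly_act (diag_rep rho) g (tens p q) = tens (poly_act rho g p) (poly_act rho g q).
Proof.
rewrite /poly_act /tens precompM; congr (_ * _).
  elim/mpoly_ind_alg: p => [c|i|p p' Hp Hp'|p p' Hp Hp'].
  - by rewrite precompC !comp_mpolyC precompC.
  - rewrite comp_mpolyXU -tnth_nth tnth_mktuple !precompX big_split_ord /=.
    rewrite [X in _ + X]big1 ?addr0 => [|j _]; last first.
      by rewrite /diag_rep block_mxEur mxE scale0r.
    rewrite raddf_sum; apply: eq_bigr => j _.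
    rewrite /diag_rep block_mxEul /= comp_mpolyZ comp_mpolyXU -tnth_nth.
    by rewrite tnth_mktuple.
  - by rewrite precompD !comp_mpolyD precompD Hp Hp'.
  - by rewrite precompM !rmorphM /= precompM Hp Hp'.
elim/mpoly_ind_alg: q => [c|i|p' p'' Hp Hp'|p' p'' Hp Hp'].
- by rewrite precompC !comp_mpolyC precompC.
- rewrite comp_mpolyXU -tnth_nth tnth_mktuple !precompX big_split_ord /=.
  rewrite big1 ?add0r => [|j _]; last first.
    by rewrite /diag_rep block_mxEdl mxE scale0r.
  rewrite raddf_sum; apply: eq_bigr => j _.
  rewrite /diag_rep block_mxEdr /= comp_mpolyZ comp_mpolyXU -tnth_nth.
  by rewrite tnth_mktuple.
- by rewrite precompD !comp_mpolyD precompD Hp Hp'.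
- by rewrite precompM !rmorphM /= precompM Hp Hp'.
Qed.

Lemma tensor_space_subspace (U W : {mpoly C[n]} -> Prop) :
  subspace U -> subspace (tensor_space U W).
Proof. by move=> sU; apply: pair_span_subspace => // c u w; apply: tensZl. Qed.

Lemma tensor_space_pihomog (U W : {mpoly C[n]} -> Prop) d t : subspace U ->
    (forall e u, U u -> U (pihomog mdeg e u)) ->
    (forall e w, W w -> W (pihomog mdeg e w)) ->
  tensor_space U W t -> tensor_space U W (pihomog mdeg d t).
Proof.
move=> sU gU gW; have sT := tensor_space_subspace W sU.
elim/pair_span_ind => [|t1 t2 H1 H2|u w Uu Ww].
- by rewrite linear0; case: sT.
- by rewrite linearD /=; apply: subspaceD.
rewrite pihomog_tens; apply: subspace_sum => // e _.
by apply: mem_pair_span; [apply: gU | apply: gW].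
Qed.

(** Stated for any bilinear map, so that a tensor and its image under
    multiplication can be expanded along the same family bs. *)
Lemma pair_span_coords k (mul : {mpoly C[n]} -> {mpoly C[n]} -> {mpoly C[k]})
    (U : {mpoly C[n]} -> Prop) (bs : seq {mpoly C[n]}) (t : {mpoly C[k]}) :
    (forall c u u' w, mul (c *: u + u') w = c *: mul u w + mul u' w) ->
    (forall c u w w', mul u (c *: w + w') = c *: mul u w + mul u w') ->
    subspace U -> pair_span mul U (in_span bs) t ->
  exists H : 'I_(size bs) -> {mpoly C[n]},
    (forall i, U (H i)) /\ t = \sum_i mul (H i) bs`_i.
Proof.
move=> mulPl mulPr sU.
have mul0l w : mul 0 w = 0.
  by have := mulPl (-1) 0 0 w; rewrite scaler0 add0r scaleN1r addNr.
have mul0r u : mul u 0 = 0.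
  by have := mulPr (-1) u 0 0; rewrite scaler0 add0r scaleN1r addNr.
elim/pair_span_ind => [|t1 t2 [H1 [U1 ->]] [H2 [U2 ->]]|u w Uu].
- exists (fun=> 0); split=> [i|]; first by case: sU.
  by rewrite big1 // => i _; rewrite mul0l.
- exists (fun i => H1 i + H2 i); split=> [i|]; first exact: subspaceD.
  rewrite -big_split; apply: eq_bigr => i _.
  by rewrite -[H1 i in RHS]scale1r mulPl scale1r.
move=> /in_spanP[c ->]; exists (fun i => c i *: u).
split=> [i|]; first exact: subspaceZ.
have mulD v v' : mul u (v + v') = mul u v + mul u v'.
  by rewrite -[v]scale1r mulPr !scale1r.
rewrite (big_morph (mul u) mulD (mul0r u)); apply: eq_bigr => i _.
rewrite -[_ *: _ in LHS]addr0 mulPr mul0r addr0.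
by rewrite -[_ *: u]addr0 mulPl mul0l addr0.
Qed.

End Tensors.

(** * Isomorphisms defined by a congruence *)

Section Congruence.
Variables (C : fieldType) (gT : finGroupType) (A : {set gT}) (n m : nat).
Variables (aU : gT -> {mpoly C[n]} -> {mpoly C[n]}).
Variables (aW : gT -> {mpoly C[m]} -> {mpoly C[m]}).
Variables (U I : {mpoly C[n]} -> Prop) (W : {mpoly C[m]} -> Prop).
Variables (mu : {mpoly C[m]} -> {mpoly C[n]}) (phi : {mpoly C[n]} -> {mpoly C[m]}).

Hypotheses (sU : subspace U) (sI : subspace I) (sW : subspace W).
Hypothesis mu_linear : forall c p q, mu (c *: p + q) = c *: mu p + mu q.
Hypothesis UI0 : forall u, U u -> I u -> u = 0.
Hypothesis WI0 : forall w, W w -> I (mu w) -> w = 0.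

Lemma congruence_unique w w' u : W w -> W w' -> I (u - mu w) -> I (u - mu w') -> w = w'.
Proof.
move=> Ww Ww' Iw Iw'; apply/eqP; rewrite -subr_eq0; apply/eqP.
apply: WI0; first exact: subspaceB.
rewrite addrC -scaleN1r mu_linear scaleN1r.
have -> : - mu w' + mu w = (u - mu w') - (u - mu w).
  by rewrite opprB [RHS]addrC addrA subrK addrC.
exact: subspaceB.
Qed.

(** If U and W are both complements of the same subspace I, the latter through
    mu, then being congruent modulo I is the graph of an isomorphism. *)
Lemma graded_iso_of_congruence :
    (forall w, W w -> exists u, U u /\ I (u - mu w)) ->
    (forall u, U u -> W (phi u) /\ I (u - mu (phi u))) ->
    (forall g p q, aU g (p - q) = aU g p - aU g q) ->
    (forall g u, g \in A -> U u -> U (aU g u)) ->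
    (forall g p, g \in A -> I p -> I (aU g p)) ->
    (forall g w, g \in A -> W w -> W (aW g w) /\ mu (aW g w) = aU g (mu w)) ->
    (forall d u, U u -> U (pihomog mdeg d u)) ->
    (forall d p, I p -> I (pihomog mdeg d p)) ->
    (forall d w, W w -> W (pihomog mdeg d w)) ->
    (forall d w, pihomog mdeg d (mu w) = mu (pihomog mdeg d w)) ->
  graded_iso A aU aW U W phi.
Proof.
move=> surj phiP aUB aU_U aU_I aW_W gU gI gW gmu; split.
- move=> c u v Uu Uv; have [Wu Iu] := phiP u Uu; have [Wv Iv] := phiP v Uv.
  have Ucv : U (c *: u + v) by case: sU => _; apply.
  have [Wc Ic] := phiP _ Ucv.
  apply: congruence_unique Wc _ Ic _; first by case: sW => _; apply.
  rewrite mu_linear opprD addrACA -scalerN -scalerDr.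
  by case: sI => _; apply.
- by move=> u /phiP[].
- move=> w Ww; have [u [Uu Iu]] := surj w Ww; have [Wu Iphi] := phiP u Uu.
  exists u; split=> [|u' [Uu' Dw]].
    by split=> //; apply: congruence_unique Wu Ww Iphi Iu.
  have [_ Iu'] := phiP u' Uu'; rewrite Dw in Iu'.
  apply/eqP; rewrite -subr_eq0; apply/eqP; apply: UI0; first exact: subspaceB.
  rewrite -(subrK (mu w) u) -addrA; apply: subspaceD => //.
  by rewrite -opprB; apply: subspaceN.
- move=> g u Ag Uu; have [Wu Iu] := phiP u Uu.
  have [Wg Ig] := phiP _ (aU_U g u Ag Uu).
  have [WgW Dmu] := aW_W g _ Ag Wu.
  by apply: congruence_unique Wg WgW Ig _; rewrite Dmu -aUB; apply: aU_I.
move=> d u Uu; have [Wu Iu] := phiP u Uu.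
rewrite !homog_piE; apply/eqP/eqP => Hd.
  apply/eqP; rewrite -subr_eq0; apply/eqP; apply: UI0.
    by apply: subspaceB => //; apply: gU.
  rewrite -(subrK (mu (phi u)) (pihomog mdeg d u)) -addrA.
  apply: subspaceD => //; last by rewrite -opprB; apply: subspaceN.
  by have := gI d _ Iu; rewrite pihomogB gmu Hd.
apply: (congruence_unique (gW d _ Wu) Wu _ Iu).
by have := gI d _ Iu; rewrite pihomogB Hd gmu.
Qed.

End Congruence.

(** * The quotient by a normal reflection subgroup *)

Section HarmonicAction.
Variables (C : numClosedFieldType) (gT : finGroupType) (n : nat).
Variables (K : {group gT}) (rho : mx_representation C K n).

(** Conjugation by an element normalising A permutes the A-invariant
    operators. *)
Lemma harmonic_act (A : {group gT}) g p : (A <| K)%g -> g \in K ->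
  is_harmonic rho A p -> is_harmonic rho A (poly_act rho g p).
Proof.
move=> /andP[sAK nAK] Kg Hp D D0 Dinv.
pose D' := precomp (rho g^-1%g)^T D.
have actD' q : diffop D (poly_act rho g q) = poly_act rho g (diffop D' q).
  exact: diffop_precomp.
rewrite actD' Hp ?poly_act0 ?mcoeff0_precomp // => a Aa q.
have Ka := subsetP sAK a Aa; apply: (poly_act_inj (rho := rho) Kg).
have Ab : (a ^ g^-1)%g \in A by rewrite memJ_norm ?groupV // (subsetP nAK).
have Kb := subsetP sAK _ Ab.
have conjga r : poly_act rho g (poly_act rho a r) =
    poly_act rho (a ^ g^-1)%g (poly_act rho g r).
  rewrite (poly_act_comp rho r Kg Ka) (poly_act_comp rho r Kb Kg).
  by rewrite conjgE invgK mulgA mulgKV.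
by rewrite -actD' !conjga Dinv // actD'.
Qed.

(** The difference of two congruent harmonic polynomials is 0. *)
Lemma harmonic_invariant_of_congruence (A : {group gT}) p : A \subset K ->
  is_harmonic rho K p ->
  (forall a, a \in A -> hilbert_ideal rho K (poly_act rho a p - p)) ->
  poly_invariant rho A p.
Proof.
move=> sAK Hp Ip a Aa; apply/eqP; rewrite -subr_eq0; apply/eqP.
apply: (harmonic_ideal0 (rho := rho)); last exact: Ip.
apply: (subspaceB (is_harmonic_subspace rho K) _ Hp).
by apply: harmonic_act Hp => //; apply: (subsetP sAK).
Qed.

End HarmonicAction.

Section Quotient.
Variables (C : numClosedFieldType) (gT : finGroupType) (n : nat).
Variables (G N : {group gT}) (rG : mx_representation C G n).
Variables (Ns : n.-tuple {mpoly C[n]}) (rE : mx_representation C (G / N)%g n).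
Hypotheses (nNG : (N <| G)%g) (reflN : generated_by_reflections rG N).
Hypotheses (coordNs : quotient_coordinates rG G N Ns).
Hypothesis repE : quotient_rep rG G Ns rE.

Let sNG : N \subset G := normal_sub nNG.
Let rN : mx_representation C N n := subg_repr rG sNG.

Local Notation iota := (comp_mpoly Ns).
Local Notation I_G := (hilbert_ideal rG G).
Local Notation I_H := (hilbert_ideal rE (G / N)%g).
Local Notation C_G := (is_harmonic rG G).
Local Notation C_N := (is_harmonic rG N).
Local Notation C_H := (quotient_harmonic G Ns rE).

Lemma iota_inj : injective iota.
Proof.
have [_ Ns_free _ _] := coordNs.
move=> p q pq; apply/eqP; rewrite -subr_eq0; apply/eqP; apply: Ns_free.
by rewrite comp_mpolyB pq subrr.
Qed.

(** An N_i of degree 0 would be a constant, contradicting algebraic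
    independence. *)
Lemma iota_degrees : exists w : 'I_n -> nat,
  (forall i, tnth Ns i \is (w i).-homog) /\ (forall i, w i != 0%N).
Proof.
have [Ns_homog _ _ _] := coordNs.
have [w Hw] := choice Ns_homog; exists w; split=> // i.
apply/eqP => wi0; have := Hw i; rewrite wi0 homog_piE pihomog0_coef => /eqP Ni.
have /iota_inj/(congr1 (mcoeff U_(i)%MM)) : iota 'X_i = iota ((tnth Ns i)@_0%MM)%:MP.
  by rewrite comp_mpolyXU -tnth_nth comp_mpolyC Ni.
rewrite mcoeffXU eqxx mcoeffC mnm1_eq0 mulr0 => /eqP.
by rewrite oner_eq0.
Qed.

Lemma mcoeff0_iota p : (iota p)@_0%MM = p@_0%MM.
Proof.
have [w [Hw w0]] := iota_degrees.
apply: mcoeff0_comp => i; apply: (dhomog_nemf_coeff (Hw i)).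
by rewrite [X in X != _]mdeg0 eq_sym w0.
Qed.

Lemma iota_act g p : g \in G ->
  poly_act rG g (iota p) = iota (poly_act rE (coset N g) p).
Proof.
move=> Gg; elim/mpoly_ind_alg: p => [c|i|p q Hp Hq|p q Hp Hq].
- by rewrite poly_actC !comp_mpolyC poly_actC.
- by rewrite [in LHS]comp_mpolyXU -tnth_nth repE.
- by rewrite poly_actD !comp_mpolyD poly_actD Hp Hq.
- by rewrite poly_actM !rmorphM /= poly_actM Hp Hq.
Qed.

Lemma iota_image f : poly_invariant rG N f <-> exists p, f = iota p.
Proof. by case: coordNs. Qed.

Lemma iota_invariant p :
  poly_invariant rG G (iota p) <-> poly_invariant rE (G / N)%g p.
Proof.
split=> Hp => [h /morphimP[g _ Gg ->]|g Gg].
  by apply: iota_inj; rewrite -iota_act // Hp.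
by rewrite iota_act // Hp // mem_quotient.
Qed.

Lemma positive_invariant_iota f : positive_invariant rG G f ->
  exists2 q, positive_invariant rE (G / N)%g q & f = iota q.
Proof.
case=> Hf f0; have /iota_image[q Dq] : poly_invariant rG N f.
  by move=> a Na; apply: Hf; apply: (subsetP sNG).
exists q => //; split; first by apply/iota_invariant; rewrite -Dq.
by rewrite -mcoeff0_iota -Dq.
Qed.

Lemma iota_ideal p : I_H p -> I_G (iota p).
Proof.
elim/pair_span_ind => [|q1 q2 H1 H2|u v _ [Hv v0]].
- by rewrite comp_mpoly0; apply: pair_span0.
- by rewrite comp_mpolyD; apply: pair_spanD.
rewrite rmorphM; apply: mem_pair_span => //; split; first exact/iota_invariant.
by rewrite mcoeff0_iota.
Qed.

(** Since the action on S(V^* ) preserves degrees and the N_i are independent,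
    those of a given degree span a subrepresentation of E^*. *)
Lemma iota_weights : exists w : 'I_n -> nat, weight_preserving rE (G / N)%g w /\
  forall d p, pihomog mdeg d (iota p) = iota (pihomog (wdeg w) d p).
Proof.
have [w [Hw _]] := iota_degrees.
have gr d p : pihomog mdeg d (iota p) = iota (pihomog (wdeg w) d p).
  by apply: pihomog_comp => i; rewrite /= wdegU.
exists w; split=> // h Hh i j nz.
have /morphimP[g _ Gg Dh] : (h^-1)%g \in (G / N)%g by rewrite groupV.
apply/eqP; apply: contraNT nz => wij.
have : pihomog (wdeg w) (w j) (poly_act rE (coset N g) 'X_i) = 0.
  apply: iota_inj; rewrite -gr comp_mpoly0 -iota_act //.
  rewrite [iota 'X_i]comp_mpolyXU -tnth_nth /poly_act pihomog_precomp.
  by rewrite (pihomog_ne0 wij (Hw i)) precomp0.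
move/(congr1 (mcoeff U_(j)%MM)); rewrite mcoeff0 mcoeff_pihomog /= wdegU eqxx.
rewrite /poly_act -[coset N g]/(coset_morphism N g) -Dh invgK precompX.
rewrite raddf_sum /= (bigD1 j) //= big1 ?addr0 => [|k kj].
  by rewrite mcoeffZ mcoeffXU eqxx mulr1 => ->.
by rewrite mcoeffZ mcoeffXU (negPf kj) mulr0.
Qed.

Lemma harmonic_G_pihomog d f : C_G f -> C_G (pihomog mdeg d f).
Proof. by rewrite pihomog_mdeg; apply: harmonic_pihomog. Qed.

Lemma harmonic_N_pihomog d f : C_N f -> C_N (pihomog mdeg d f).
Proof.
rewrite pihomog_mdeg.
exact: (harmonic_pihomog (rho := rN) d (@weight_preserving1 _ _ _ rN N)).
Qed.

Lemma quotient_harmonic_pihomog d f : C_H f -> C_H (pihomog mdeg d f).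
Proof.
case=> p Hp ->; have [w [wp gr]] := iota_weights.
by exists (pihomog (wdeg w) d p) => //; apply: harmonic_pihomog.
Qed.

Lemma hilbert_ideal_G_pihomog d f : I_G f -> I_G (pihomog mdeg d f).
Proof. by rewrite pihomog_mdeg; apply: hilbert_ideal_pihomog. Qed.

Lemma quotient_harmonic_subspace : subspace C_H.
Proof.
have [H0 HP] := is_harmonic_subspace rE (G / N)%g.
split=> [|c _ _ [p Hp ->] [q Hq ->]]; first by exists 0; rewrite ?comp_mpoly0.
by exists (c *: p + q); [apply: HP | rewrite linearP].
Qed.

Lemma quotient_harmonic_act g f : g \in G -> C_H f -> C_H (poly_act rG g f).
Proof.
move=> Gg [p Hp ->]; exists (poly_act rE (coset N g) p); last exact: iota_act.
by apply: harmonic_act => //; apply: mem_quotient.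
Qed.

Local Notation T := (tensor_space C_H C_N).

Lemma tensor_harmonic_act g t : g \in G -> T t ->
  T (poly_act (diag_rep rG) g t) /\
  diagonal (poly_act (diag_rep rG) g t) = poly_act rG g (diagonal t).
Proof.
move=> Gg.
have diag0 : diagonal 0 = 0 :> {mpoly C[n]} by apply: linear0.
have diagD (s u : {mpoly C[n + n]}) : diagonal (s + u) = diagonal s + diagonal u.
  exact: linearD.
elim/pair_span_ind => [|t1 t2 [T1 E1] [T2 E2]|u v Uu Vv].
- by rewrite poly_act0 diag0 poly_act0; split=> //; apply: pair_span0.
- rewrite poly_actD !diagD poly_actD E1 E2; split=> //; exact: pair_spanD.
rewrite poly_act_tens !diagonal_tens poly_actM; split=> //.
by apply: mem_pair_span; [apply: quotient_harmonic_act | apply: harmonic_act].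
Qed.

(** A G-invariant q is an element of S(E^* )^H, so multiplying by it the
    decomposition S(V^* ) = S(V^* )^N C_N puts the coefficients in I_H. *)
Lemma hilbert_ideal_expansion f : I_G f ->
  pair_span *%R (fun u => exists2 p, I_H p & u = iota p) C_N f.
Proof.
have sIH := hilbert_ideal_subspace rE (G / N)%g.
set J := fun u => _; have sM : subspace (pair_span *%R J C_N).
  apply: pair_span_subspace => [|c u w]; last by rewrite scalerAl.
  have [J0 JP] := sIH; split=> [|c _ _ [p Ip ->] [q Iq ->]].
    by exists 0; rewrite ?comp_mpoly0.
  by exists (c *: p + q); [apply: JP | rewrite linearP].
elim/pair_span_ind => [|q1 q2 H1 H2|s _ _ /positive_invariant_iota[q Hq ->]].
- by case: sM.
- exact: subspaceD.
have : pair_span *%R (poly_invariant rG N) C_N s := harmonic_span_full rN s.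
elim/pair_span_ind => [|q1 q2 H1 H2|_ v /iota_image[p ->] Hv].
- by rewrite mul0r; case: sM.
- by rewrite mulrDl; apply: subspaceD.
rewrite mulrAC -rmorphM; apply: mem_pair_span => //.
by exists (p * q) => //; apply: mem_pair_span.
Qed.

(** Injectivity of multiplication modulo I_G: as S(V^* ) is free over
    S(V^* )^N, two expansions of an element along the same independent family
    of C_N coincide, here one with coefficients in C_H and one with
    coefficients in I_H. *)
Lemma tensor_harmonic_disjoint t : T t -> I_G (diagonal t) -> t = 0.
Proof.
move=> Tt /hilbert_ideal_expansion; have [s Hs Dt] := Tt; case=> s' Hs' Ds'.
(* One family serves for both expansions of diagonal t. *)
have [bs [fbs bs_cs cs_bs]] := free_family_extract [seq p.2 | p <- s ++ s'].
have bs_N i : (i < size bs)%N -> C_N bs`_i.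
  move=> /(mem_nth 0)/bs_cs/mapP[p]; rewrite mem_cat => /orP[/Hs|/Hs'] [_ Hp] -> //.
have indep (c : 'I_(size bs) -> C) :
    hilbert_ideal rN N (\sum_i c i *: bs`_i) -> forall i, c i = 0.
  move=> Ic; apply: (free_family_coeffs fbs).
  apply: (harmonic_ideal0 (rho := rN)) Ic.
  apply: subspace_sum (is_harmonic_subspace rN N) _ => i _.
  by apply: subspaceZ (is_harmonic_subspace rN N) _; apply: bs_N.
have Ts : pair_span (@tens C n) C_H (in_span bs) t.
  exists s => // p ps; split; first by case: (Hs p ps).
  by apply: cs_bs; apply: map_f; rewrite mem_cat ps.
have Ts' : pair_span *%R (fun u => exists2 p, I_H p & u = iota p) (in_span bs) (diagonal t).
  exists s' => // p ps; split; first by case: (Hs' p ps).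
  by apply: cs_bs; apply: map_f; rewrite mem_cat ps orbT.
have [H [HH Dt2]] : exists H : 'I_(size bs) -> {mpoly C[n]},
    (forall i, C_H (H i)) /\ t = \sum_i tens (H i) bs`_i.
  apply: pair_span_coords Ts; last exact: quotient_harmonic_subspace.
    by move=> c u u' w; rewrite tensDl tensZl.
  by move=> c u w w'; rewrite tensDr tensZr.
have [J [HJ DJ]] : exists J : 'I_(size bs) -> {mpoly C[n]},
    (forall i, exists2 p, I_H p & J i = iota p) /\ diagonal t = \sum_i J i * bs`_i.
  apply: pair_span_coords Ts'.
  - by move=> c u u' w; rewrite mulrDl scalerAl.
  - by move=> c u w w'; rewrite mulrDr scalerAr.
  have [J0 JP] := hilbert_ideal_subspace rE (G / N)%g.
  split=> [|c _ _ [p Ip ->] [q Iq ->]]; first by exists 0; rewrite ?comp_mpoly0.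
  by exists (c *: p + q); [apply: JP | rewrite linearP].
have DH : diagonal t = \sum_i H i * bs`_i.
  rewrite Dt2 [LHS]raddf_sum; apply: eq_bigr => i _; exact: diagonal_tens.
have HJ0 : forall i, H i - J i = 0.
  apply: (independent_over_invariants (rho := rN) reflN indep) => [i|].
    have [p _ ->] := HH i; have [q _ ->] := HJ i.
    by apply/iota_image; exists (p - q); rewrite comp_mpolyB.
  under eq_bigr do rewrite mulrC mulrBl.
  by rewrite sumrB -DH -DJ subrr.
rewrite Dt2 big1 // => i _.
have [p Hp DHi] := HH i; have [q Iq DJi] := HJ i.
have pq : p = q by apply: iota_inj; apply/eqP; rewrite -subr_eq0 -DHi -DJi HJ0.
rewrite DHi (harmonic_ideal0 Hp) ?pq // comp_mpoly0.
by rewrite /tens comp_mpoly0 mul0r.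
Qed.

(** Replacing p = (p - j) + j by its harmonic part p - j changes the product
    by an element of I_G, as I_H is contained in I_G. *)
Lemma tensor_harmonic_surjective f : exists t, T t /\ I_G (f - diagonal t).
Proof.
have sI := hilbert_ideal_subspace rG G.
have : pair_span *%R (poly_invariant rG N) C_N f := harmonic_span_full rN f.
elim/pair_span_ind => [|f1 f2 [t1 [T1 I1]] [t2 [T2 I2]]|_ v /iota_image[p ->] Hv].
- exists 0; split; first exact: pair_span0.
  by rewrite /diagonal comp_mpoly0 subrr; case: sI.
- exists (t1 + t2); split; first exact: pair_spanD.
  rewrite /diagonal comp_mpolyD -/(diagonal t1) -/(diagonal t2) opprD addrACA.
  exact: subspaceD.
have [j [Ij Hj]] := harmonic_decomposition rE p.
exists (tens (iota (p - j)) v); split.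
  by apply: mem_pair_span => //; exists (p - j).
rewrite diagonal_tens -mulrBl comp_mpolyB opprB addrC subrK mulrC.
by apply: hilbert_idealM; apply: iota_ideal.
Qed.

Lemma tens1_inj (f : {mpoly C[n]}) : tens f 1 = 0 -> f = 0.
Proof.
move/(congr1 (@diagonal C n)); rewrite diagonal_tens mulr1 => ->.
by rewrite /diagonal comp_mpoly0.
Qed.

Lemma tens1_harmonic f : C_H f -> T (tens f 1).
Proof. by move=> Hf; apply: mem_pair_span => //; apply: is_harmonic1. Qed.

Lemma harmonic_tensor_isomorphism :
  let C_G_N := fun f => C_G f /\ poly_invariant rG N f in
  exists phi : {mpoly C[n]} -> {mpoly C[n + n]},
  exists psi : {mpoly C[n]} -> {mpoly C[n]},
  [/\ graded_iso G (poly_act rG) (poly_act (diag_rep rG)) C_G T phi,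
      graded_iso (G / N)%g (@coset_poly_act _ _ _ rG N)
        (@coset_poly_act _ _ _ rG N) C_G_N C_H psi
    & forall f, C_G_N f -> phi f = tens (psi f) 1].
Proof.
move=> C_G_N.
have sI := hilbert_ideal_subspace rG G; have sCG := is_harmonic_subspace rG G.
have sT : subspace T := tensor_space_subspace _ quotient_harmonic_subspace.
have sCGN : subspace C_G_N.
  have [c0 cP] := sCG; have [i0 iP] := poly_invariant_subspace rG N.
  by split=> [|c u v [Cu Iu] [Cv Iv]]; split; [|exact: i0|apply: cP|apply: iP].
have projG f : exists u, C_G u /\ I_G (u - f).
  have [j [Ij Hj]] := harmonic_decomposition rG f.
  exists (f - j); split=> //; rewrite addrC addKr; exact: subspaceN.
have H_disjoint f : C_H f -> I_G f -> f = 0.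
  move=> Hf If; apply: tens1_inj; apply: tensor_harmonic_disjoint; first exact: tens1_harmonic.
  by rewrite diagonal_tens mulr1.
have projH u : exists f, C_G_N u -> C_H f /\ I_G (u - f).
  have [[_ /iota_image[p Dp]]|nu] := EM (C_G_N u); last by exists 0 => /nu.
  have [j [Ij Hj]] := harmonic_decomposition rE p.
  exists (iota (p - j)) => _; split; first by exists (p - j).
  by rewrite Dp comp_mpolyB opprB addrC subrK; apply: iota_ideal.
have [phi phiP] := choice tensor_harmonic_surjective; have [psi psiP] := choice projH.
have reprG h : h \in (G / N)%g -> repr h \in G.
  case/morphimP=> g _ Gg ->; have := mem_repr_coset (coset N g).
  have nNg : g \in 'N(N)%g by apply: (subsetP (normal_norm nNG)).
  by rewrite val_coset // => /rcosetP[a Na ->]; rewrite groupM // (subsetP sNG).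
have CG_act g f : g \in G -> C_G f -> C_G (poly_act rG g f).
  by move=> Gg; apply: harmonic_act.
exists phi, psi; split.
- apply: (graded_iso_of_congruence (I := I_G) (mu := @diagonal C n)) => //.
  + exact: diagonalP.
  + exact: harmonic_ideal0.
  + exact: tensor_harmonic_disjoint.
  + by move=> g p q; apply: poly_actB.
  + by move=> g p Gg; apply: hilbert_ideal_act.
  + exact: tensor_harmonic_act.
  + exact: harmonic_G_pihomog.
  + exact: hilbert_ideal_G_pihomog.
  + move=> d t; apply: tensor_space_pihomog; first exact: quotient_harmonic_subspace.
      exact: quotient_harmonic_pihomog.
    exact: harmonic_N_pihomog.
  + exact: pihomog_diagonal.
- apply: (graded_iso_of_congruence (I := I_G) (mu := id)) => //.
  + exact: quotient_harmonic_subspace.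
  + by move=> u [Cu _]; apply: harmonic_ideal0.
  + move=> f Hf; have [u [Cu Iu]] := projG f; exists u; split=> //; split=> //.
    apply: harmonic_invariant_of_congruence => // a Na; have Ga := subsetP sNG a Na.
    have fN : poly_act rG a f = f.
      by have [p _ Dp] := Hf; apply: (proj2 (iota_image f)) => //; exists p.
    have -> : poly_act rG a u - u = poly_act rG a (u - f) - (u - f).
      by rewrite poly_actB fN opprB addrA subrK.
    by apply: subspaceB => //; apply: hilbert_ideal_act.
  + by move=> h p q; apply: poly_actB.
  + move=> h u Hh [Cu Nu]; have Gh := reprG h Hh; split; first exact: CG_act.
    have [p ->] : exists p, u = iota p by apply/iota_image.
    by rewrite /coset_poly_act iota_act //; apply/iota_image; eexists.
  + by move=> h p Hh; apply: hilbert_ideal_act; apply: reprG.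
  + by move=> h f Hh Hf; split=> //; apply: quotient_harmonic_act => //; apply: reprG.
  + move=> d u [Cu Nu]; split; first exact: harmonic_G_pihomog.
    rewrite pihomog_mdeg.
    exact: (poly_invariant_pihomog (rho := rN) d (@weight_preserving1 _ _ _ rN N)).
  + exact: hilbert_ideal_G_pihomog.
  + exact: quotient_harmonic_pihomog.
move=> f Ff; have [Hf If] := psiP f Ff; have [Tf Iphi] := phiP f.
apply: (congruence_unique sI sT (@diagonalP C n) tensor_harmonic_disjoint
         Tf (tens1_harmonic Hf) Iphi).
by rewrite diagonal_tens mulr1.
Qed.

End Quotient.

Local Open Scope complex_scope.

Theorem proposition3p3 (R : realType) (gT : finGroupType) (G N : {group gT})
    (r : nat) (rG : mx_representation R[i] G r)
    (Ns : r.-tuple {mpoly R[i][r]})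
    (rE : mx_representation R[i] (G / N)%g r) :
  mx_faithful rG -> generated_by_reflections rG G ->
  (N <| G)%g -> generated_by_reflections rG N ->
  quotient_coordinates rG G N Ns ->
  quotient_rep rG G Ns rE ->
  let C_G := is_harmonic rG G in
  let C_N := is_harmonic rG N in
  let C_H := quotient_harmonic G Ns rE in
  let C_G_N := fun f => C_G f /\ poly_invariant rG N f in
  exists phi : {mpoly R[i][r]} -> {mpoly R[i][r + r]},
  exists psi : {mpoly R[i][r]} -> {mpoly R[i][r]},
  [/\ graded_iso G (poly_act rG) (poly_act (diag_rep rG))
        C_G (tensor_space C_H C_N) phi,
      graded_iso (G / N)%g (@coset_poly_act _ _ _ rG N)
        (@coset_poly_act _ _ _ rG N) C_G_N C_H psi
    & forall f, C_G_N f -> phi f = tens (psi f) 1].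
Proof.
move=> _ _ nNG reflN coordNs repE.
exact: harmonic_tensor_isomorphism nNG reflN coordNs repE.
Qed.
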